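(* Let $k$ be a field, $G$ a finite group, and $X$ a set of representatives of the conjugacy classes of $G$. For $x,y\in X$ and classes $[\widehat\varphi_x]\in H^n(C_G(x),k)$, $[\widehat\varphi_y]\in H^m(C_G(y),k)$ represented by cocycles $\widehat\varphi_x:\overline{C_G(x)}^{\times n}\to k$ and $\widehat\varphi_y:\overline{C_G(y)}^{\times m}\to k$, define $$[\widehat\varphi_x\cup\widehat\varphi_y]=\sum_{z\in X}[(\widehat\varphi_x\cup\widehat\varphi_y)_z]\in\bigoplus_{z\in X}H^*(C_G(z),k),$$ where $(\widehat\varphi_x\cup\widehat\varphi_y)_z:\overline{C_G(z)}^{\times(n+m)}\to k$ is given by $$(\widehat\varphi_x\cup\widehat\varphi_y)_z(h_1,\dots,h_{n+m})=(-1)^{nm}\sum_{(i,j)\in I_1}\widehat\varphi_x(h'_{i,1},\dots,h'_{i,n})\,\widehat\varphi_y(h'_{j,1},\dots,h'_{j,m}).$$ Here $I_1$ is the set of pairs $(i,j)$, $1\le i\le n_x$, $1\le j\le n_y$, such that $$h_1\cdots h_m\,x_i\,(h_1\cdots h_m)^{-1}\,y_j=z,$$ the elements $h'_{i,1},\dots,h'_{i,n}\in C_G(x)$ are determined by $$\gamma_{i,x}h_{m+1}=h'_{i,1}\gamma_{s_i^1,x},\quad\gamma_{s_i^1,x}h_{m+2}=h'_{i,2}\gamma_{s_i^2,x},\quad\dots,\quad\gamma_{s_i^{n-1},x}h_{n+m}=h'_{i,n}\gamma_{s_i^n,x},$$ and the elements $h'_{j,1},\dots,h'_{j,m}\in C_G(y)$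 are determined by $$\gamma_{j,y}h_1=h'_{j,1}\gamma_{s_j^1,y},\quad\gamma_{s_j^1,y}h_2=h'_{j,2}\gamma_{s_j^2,y},\quad\dots,\quad\gamma_{s_j^{m-1},y}h_m=h'_{j,m}\gamma_{s_j^m,y}.$$ With this product on $\bigoplus_{x\in X}H^*(C_G(x),k)$, the linear isomorphism $$HH^*(kG)\xrightarrow{\ \sim\ }\bigoplus_{x\in X}H^*(C_G(x),k),\qquad [\varphi:\overline{G}^{\times n}\to kG]\longmapsto\bigoplus_{x\in X}[\widehat\varphi_x],$$ where $\widehat\varphi_x(h_1,\dots,h_n)$ (for $h_1,\dots,h_n\in\overline{C_G(x)}$) is the coefficient of $x$ in $(-1)^{\frac{n(n+1)}{2}}h_1\cdots h_n\,\varphi(h_n^{-1},\dots,h_1^{-1})\in kG$, is an isomorphism of graded algebras, where $HH^*(kG)$ carries the cup product.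
   Context: For a group $H$ write $\overline{H}=H\setminus\{1\}$. For a $k$-vector space $V$, $\mathrm{Map}(\overline{H}^{\times n},V)$ denotes all maps of sets, identified with $\mathrm{Hom}_k((kH/k\cdot 1)^{\otimes n},V)$ (and with $V$ for $n=0$); accordingly, in every formula such a map takes the value $0$ whenever one of its arguments equals $1$. Hochschild cohomology: $HH^*(kG)$ is the cohomology of $\mathrm{Map}(\overline{G}^{\times n},kG)$ with differential $\delta_0(a)(g)=ga-ag$ and $$\delta_n(\varphi)(g_1,\dots,g_{n+1})=g_1\varphi(g_2,\dots,g_{n+1})+\sum_{i=1}^n(-1)^i\varphi(g_1,\dots,g_ig_{i+1},\dots,g_{n+1})+(-1)^{n+1}\varphi(g_1,\dots,g_n)g_{n+1}.$$ The cup product on $HH^*(kG)$ is induced by $(\varphi\cup\psi)(g_1,\dots,g_{n+m})=\varphi(g_1,\dots,g_n)\psi(g_{n+1},\dots,g_{n+m})$. Group cohomology: for a finite group $H$, $H^*(H,k)$ (trivial coefficients) is the cohomology of $\mathrm{Map}(\overline{H}^{\times n},k)$ with $$\delta_n(\psi)(h_1,\dots,h_{n+1})=\psi(h_2,\dots,h_{n+1})+\sum_{i=1}^n(-1)^i\psi(h_1,\dots,h_ih_{i+1},\dots,h_{n+1})+(-1)^{n+1}\psi(h_1,\dots,h_n).$$ For $x\in X$: $C_x$ is the conjugacy class of $x$, $C_G(x)$ the centralizer of $x$, $n_x=|C_x|=[G:C_G(x)]$; fix right coset representatives $\gamma_{1,x}=1,\gamma_{2,x},\dots,\gamma_{n_x,x}$,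 so that $G=\bigsqcup_{i=1}^{n_x}C_G(x)\gamma_{i,x}$, and put $x_i=\gamma_{i,x}^{-1}x\gamma_{i,x}$, so $C_x=\{x_1=x,x_2,\dots,x_{n_x}\}$; similarly $y_j=\gamma_{j,y}^{-1}y\gamma_{j,y}$ for $y\in X$. Since the cosets are disjoint, for $g\in G$ and $1\le i\le n_x$ the equation $\gamma_{i,x}g=h\gamma_{s,x}$ determines $h\in C_G(x)$ and the index $s$ uniquely. *)

(* Defs.v *)
From HB Require Import structures.
From mathcomp Require Import all_boot all_order all_algebra all_fingroup.

Set Implicit Arguments.
Unset Strict Implicit.
Unset Printing Implicit Defensive.

Import GRing.Theory.
Local Open Scope quotient_scope.
Local Open Scope ring_scope.

(* The finite group G is [set: gT], so that C_G(x) is 'C[x] and the conjugacy *)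
(* class of x is x ^: [set: gT].                                              *)

Section GroupAlgebra.
Variables (k : fieldType) (gT : finGroupType).

(* An alias of {ffun gT -> k^o}, whose own ring product is pointwise.         *)
Definition grpalg : Type := {ffun gT -> k^o}.
HB.instance Definition _ := Vector.copy grpalg {ffun gT -> k^o}.

Definition gcoef (a : grpalg) (g : gT) : k := (a : {ffun gT -> k^o}) g.

Definition gelt (g : gT) : grpalg := [ffun u => (u == g)%:R : k^o].

Definition ga_mul (a b : grpalg) : grpalg :=
  [ffun g => \sum_u gcoef a u * gcoef b (u^-1 * g)%g : k^o].

Let ga_mulE a b g :
  gcoef (ga_mul a b) g = \sum_u gcoef a u * gcoef b (u^-1 * g)%g.
Proof. by rewrite /gcoef ffunE. Qed.

Lemma geltE g u : gcoef (gelt g) u = (u == g)%:R.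
Proof. by rewrite /gcoef ffunE. Qed.

Lemma gcoefP a b : gcoef a =1 gcoef b -> a = b.
Proof. by move=> eq_ab; apply/ffunP. Qed.

Lemma gcoefD a b g : gcoef (a + b) g = gcoef a g + gcoef b g.
Proof. by rewrite /gcoef ffunE. Qed.

Lemma gcoefZ c a g : gcoef (c *: a) g = c * gcoef a g.
Proof. by rewrite /gcoef ffunE. Qed.

Let ga_mulA : associative ga_mul.
Proof.
move=> a b c; apply: gcoefP => g; rewrite !ga_mulE.
under eq_bigr do rewrite ga_mulE mulr_sumr.
under [RHS]eq_bigr do rewrite ga_mulE mulr_suml.
rewrite [RHS]exchange_big; apply: eq_bigr => u _.
rewrite [RHS](reindex_inj (mulgI u)); apply: eq_bigr => v _ /=.
by rewrite mulrA mulKg invMg mulgA.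
Qed.

Let ga_mul1 : left_id (gelt 1%g) ga_mul.
Proof.
move=> a; apply: gcoefP => g; rewrite ga_mulE (bigD1 1%g) //= big1 ?addr0.
  by rewrite geltE eqxx mul1r invg1 mul1g.
by move=> u u1; rewrite geltE (negPf u1) mul0r.
Qed.

Let ga_mul1r : right_id (gelt 1%g) ga_mul.
Proof.
move=> a; apply: gcoefP => g; rewrite ga_mulE (bigD1 g) //= big1 ?addr0.
  by rewrite geltE mulVg eqxx mulr1.
by move=> u ug; rewrite geltE -eq_mulVg1 (negPf ug) mulr0.
Qed.

Let ga_mulDl : left_distributive ga_mul +%R.
Proof.
move=> a b c; apply: gcoefP => g; rewrite gcoefD !ga_mulE -big_split /=.
by apply: eq_bigr => u _; rewrite gcoefD mulrDl.
Qed.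

Let ga_mulDr : right_distributive ga_mul +%R.
Proof.
move=> a b c; apply: gcoefP => g; rewrite gcoefD !ga_mulE -big_split /=.
by apply: eq_bigr => u _; rewrite gcoefD mulrDr.
Qed.

Let ga_oner_neq0 : gelt 1%g != 0.
Proof.
apply/eqP => /(congr1 (fun a => gcoef a 1%g)); rewrite geltE /gcoef ffunE eqxx.
by apply/eqP/oner_neq0.
Qed.

HB.instance Definition _ := GRing.Zmodule_isNzRing.Build grpalg
  ga_mulA ga_mul1 ga_mul1r ga_mulDl ga_mulDr ga_oner_neq0.

Lemma gcoefM (a b : grpalg) g :
  gcoef (a * b) g = \sum_u gcoef a u * gcoef b (u^-1 * g)%g.
Proof. exact: ga_mulE. Qed.

Let ga_scaleAl c (a b : grpalg) : c *: (a * b) = c *: a * b.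
Proof.
apply: gcoefP => g; rewrite gcoefZ !gcoefM mulr_sumr.
by apply: eq_bigr => u _; rewrite gcoefZ mulrA.
Qed.

HB.instance Definition _ := GRing.Lmodule_isLalgebra.Build k grpalg ga_scaleAl.

Let ga_scaleAr c (a b : grpalg) : c *: (a * b) = a * (c *: b).
Proof.
apply: gcoefP => g; rewrite gcoefZ !gcoefM mulr_sumr.
by apply: eq_bigr => u _; rewrite gcoefZ mulrCA.
Qed.

HB.instance Definition _ := GRing.Lalgebra_isAlgebra.Build k grpalg ga_scaleAr.

End GroupAlgebra.

Section Quotient.
Variables (k : fieldType) (V : vectType k) (W : {vspace V}).

Definition vquot : Type := Quotient.quot (pred_of_vspace W).
HB.instance Definition _ := GRing.Zmodule.on vquot.

Definition vquot_pi (v : V) : vquot := \pi_(Quotient.quot (pred_of_vspace W)) v.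
Definition vquot_repr (c : vquot) : V :=
  generic_quotient.repr (c : Quotient.quot (pred_of_vspace W)).

Lemma vquot_reprK c : vquot_pi (vquot_repr c) = c.
Proof. exact: reprK. Qed.

Lemma vquot_piP u v : vquot_pi u = vquot_pi v <-> u - v \in W.
Proof.
by rewrite Quotient.idealrBE; split=> [/eqP|/eqP].
Qed.

Lemma vquot_piD u v : vquot_pi (u + v) = vquot_pi u + vquot_pi v.
Proof. exact: raddfD. Qed.

Definition vquot_scale (c : k) (q : vquot) : vquot :=
  vquot_pi (c *: vquot_repr q).

Lemma vquot_piZ c v : vquot_scale c (vquot_pi v) = vquot_pi (c *: v).
Proof.
apply/vquot_piP; rewrite -scalerBr rpredZ //.
by apply/vquot_piP; apply: vquot_reprK.
Qed.

Let vquot_scaleA a b q :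
  vquot_scale a (vquot_scale b q) = vquot_scale (a * b) q.
Proof. by rewrite -(vquot_reprK q) !vquot_piZ scalerA. Qed.

Let vquot_scale1 : left_id 1 vquot_scale.
Proof. by move=> q; rewrite -(vquot_reprK q) vquot_piZ scale1r. Qed.

Let vquot_scaleDr : right_distributive vquot_scale +%R.
Proof.
move=> c p q; rewrite -(vquot_reprK p) -(vquot_reprK q).
by rewrite -vquot_piD !vquot_piZ scalerDr vquot_piD.
Qed.

Let vquot_scaleDl q : {morph vquot_scale^~ q : a b / a + b}.
Proof.
by move=> a b; rewrite -(vquot_reprK q) !vquot_piZ scalerDl vquot_piD.
Qed.

HB.instance Definition _ := GRing.Zmodule_isLmodule.Build k vquot
  vquot_scaleA vquot_scale1 vquot_scaleDr vquot_scaleDl.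

End Quotient.

Section DirectSum.
Variables (k : fieldType) (I : finType) (V : I -> lmodType k).

Definition dsum : Type := {dffun forall i, V i}.
HB.instance Definition _ := Choice.copy dsum {dffun forall i, V i}.

Definition dproj (a : dsum) (i : I) : V i := (a : {dffun forall i, V i}) i.
Definition dtuple (f : forall i, V i) : dsum := finfun f.

Lemma dtupleE f i : dproj (dtuple f) i = f i.
Proof. exact: ffunE. Qed.

Lemma dprojP a b : (forall i, dproj a i = dproj b i) -> a = b.
Proof. by move=> eq_ab; apply/ffunP. Qed.

Let dadd a b := dtuple (fun i => dproj a i + dproj b i).
Let dzero := dtuple (fun i => 0).
Let dopp a := dtuple (fun i => - dproj a i).
Let dscale c a := dtuple (fun i => c *: dproj a i).

Let daddA : associative dadd.
Proof. by move=> a b c; apply: dprojP => i; rewrite !dtupleE addrA. Qed.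
Let daddC : commutative dadd.
Proof. by move=> a b; apply: dprojP => i; rewrite !dtupleE addrC. Qed.
Let dadd0 : left_id dzero dadd.
Proof. by move=> a; apply: dprojP => i; rewrite !dtupleE add0r. Qed.
Let daddN : left_inverse dzero dopp dadd.
Proof. by move=> a; apply: dprojP => i; rewrite !dtupleE addNr. Qed.

HB.instance Definition _ :=
  GRing.isZmodule.Build dsum daddA daddC dadd0 daddN.

Let dscaleA c e a : dscale c (dscale e a) = dscale (c * e) a.
Proof. by apply: dprojP => i; rewrite !dtupleE scalerA. Qed.
Let dscale1 : left_id 1 dscale.
Proof. by move=> a; apply: dprojP => i; rewrite !dtupleE scale1r. Qed.
Let dscaleDr : right_distributive dscale +%R.
Proof. by move=> c a b; apply: dprojP => i; rewrite !dtupleE scalerDr. Qed.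
Let dscaleDl a : {morph dscale^~ a : c e / c + e}.
Proof. by move=> c e; apply: dprojP => i; rewrite !dtupleE scalerDl. Qed.

HB.instance Definition _ := GRing.Zmodule_isLmodule.Build k dsum
  dscaleA dscale1 dscaleDr dscaleDl.

End DirectSum.

Section GradedAlgebra.
Variable k : fieldType.

(* A graded algebra is given by its homogeneous components; associativity and *)
(* the right unit law compare components whose degrees are only provably      *)
(* equal.                                                                     *)
Definition deg_cast (A : nat -> lmodType k) m n (e : m = n) (a : A m) : A n :=
  ecast i (A i) e a.

Definition graded_algebra (A : nat -> lmodType k)
    (mul : forall n m, A n -> A m -> A (n + m)%N) (one : A 0%N) : Prop :=
  [/\ forall n m (b : A m), linear (fun a : A n => mul n m a b),
      forall n m (a : A n), linear (mul n m a),
      forall n m p (a : A n) (b : A m) (c : A p),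
        deg_cast (addnA n m p) (mul n (m + p)%N a (mul m p b c))
        = mul (n + m)%N p (mul n m a b) c,
      forall n (a : A n), deg_cast (add0n n) (mul 0%N n one a) = a
    & forall n (a : A n), deg_cast (addn0 n) (mul n 0%N a one) = a].

Definition graded_algebra_iso
    (A : nat -> lmodType k) (mulA : forall n m, A n -> A m -> A (n + m)%N)
    (oneA : A 0%N)
    (B : nat -> lmodType k) (mulB : forall n m, B n -> B m -> B (n + m)%N)
    (oneB : B 0%N)
    (f : forall n, A n -> B n) : Prop :=
  [/\ forall n, linear (f n),
      forall n, bijective (f n),
      forall n m (a : A n) (b : A m),
        f (n + m)%N (mulA n m a b) = mulB n m (f n a) (f m b)
    & f 0%N oneA = oneB].

End GradedAlgebra.

Section Cohomology.
Variables (k : fieldType) (C : nat -> vectType k).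
Variable d : forall n, {linear C n -> C n.+1}.

Definition cocycles n : {vspace C n} := lker (linfun (d n)).

Definition coboundaries n : {vspace C n} :=
  match n with
  | 0 => 0%VS
  | m.+1 => limg (linfun (d m))
  end.

Definition cohom n : lmodType k :=
  vquot (linfun (vsval : subvs_of (cocycles n) -> C n)
           @^-1: coboundaries n)%VS.

(* Meaningful only when a is a cocycle.                                       *)
Definition cohom_class n (a : C n) : cohom n :=
  vquot_pi _ (vsproj (cocycles n) a).

Definition cohom_repr n (c : cohom n) : C n := vsval (vquot_repr c).

End Cohomology.

Section BarComplex.
Variables (k : fieldType) (gT : finGroupType) (H : {group gT}).

Definition bar : finType := {h : gT | h \in H^#%g}.

Definition cochain (V : vectType k) n : vectType k := {ffun n.-tuple bar -> V}.

(* The value of phi at s = [:: h_1; ...; h_n], for h_i in H, with the         *)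
(* convention that it is 0 as soon as some h_i is 1.                          *)
Definition ceval (V : vectType k) n (phi : cochain V n) (s : seq gT) : V :=
  if all [in H^#%g] s then oapp phi 0 (insub (pmap insub s)) else 0.

Definition unbar n (t : n.-tuple bar) : seq gT := map val t.

Lemma ceval_unbar (V : vectType k) n (phi : cochain V n) (t : n.-tuple bar) :
  ceval phi (unbar t) = phi t.
Proof.
rewrite /ceval /unbar; case: allP => [_|[] _ /mapP[h _ ->]]; last exact: valP.
by rewrite (map_pK (@valK _ _ bar)) valK.
Qed.

Lemma ceval1 (V : vectType k) n (phi : cochain V n) (s : seq gT) :
  1%g \in s -> ceval phi s = 0.
Proof.
rewrite /ceval => s1; case: allP => // /(_ _ s1).
by rewrite /= !inE eqxx.
Qed.

(* [:: g_1; ...; g_i * g_(i+1); ...; g_(n+1)], with i counted from 1.         *)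
Definition bar_face i (s : seq gT) : seq gT :=
  take i.-1 s ++ (nth 1 s i.-1 * nth 1 s i)%g :: drop i.+1 s.

Section Differential.
Variables (V : vectType k) (la ra : gT -> {linear V -> V}).

Definition bar_diff n (phi : cochain V n) : cochain V n.+1 :=
  [ffun t => let s := unbar t in
     la (head 1%g s) (ceval phi (behead s))
     + \sum_(1 <= i < n.+1) (-1) ^+ i *: ceval phi (bar_face i s)
     + (-1) ^+ n.+1 *: ra (last 1%g s) (ceval phi (take n s))].

Lemma cevalP n a (phi psi : cochain V n) s :
  ceval (a *: phi + psi) s = a *: ceval phi s + ceval psi s.
Proof.
rewrite /ceval; case: ifP => _; last by rewrite scaler0 addr0.
by case: insub => [t|] /=; rewrite ?ffunE ?scaler0 ?addr0.
Qed.

Let bar_diff_linear n : linear (@bar_diff n).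
Proof.
move=> a phi psi; apply/ffunP => t; rewrite !ffunE /= !cevalP !linearP /=.
under eq_bigr do rewrite cevalP scalerDr scalerA mulrC -scalerA.
rewrite big_split /= -scaler_sumr !scalerDr.
by rewrite [RHS]addrACA; congr (_ + _); rewrite addrACA.
Qed.

HB.instance Definition _ n :=
  GRing.isLinear.Build k (cochain V n) (cochain V n.+1) *:%R (@bar_diff n)
    (@bar_diff_linear n).

End Differential.

Definition trivial_diff n :
    {linear cochain (k^o : vectType k) n -> cochain (k^o : vectType k) n.+1} :=
  @bar_diff (k^o) (fun _ => idfun) (fun _ => idfun) n.

Definition group_cohom n : lmodType k := cohom trivial_diff n.

End BarComplex.

Section Hochschild.
Variables (k : fieldType) (gT : finGroupType).
Local Notation kG := (grpalg k gT).
Local Notation G := [set: gT]%G.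

Definition hoch_cochain n : vectType k := cochain G (kG : vectType k) n.

Definition hoch_diff n : {linear hoch_cochain n -> hoch_cochain n.+1} :=
  @bar_diff k gT G kG (fun g => gelt k g \*o idfun) (fun g => gelt k g \o* idfun) n.

Definition HH n : lmodType k := cohom hoch_diff n.

Definition hoch_cup n m (phi : hoch_cochain n) (psi : hoch_cochain m) :
    hoch_cochain (n + m) :=
  [ffun t => let s := unbar t in
     ceval phi (take n s) * ceval psi (drop n s)].

Definition HH_mul n m (a : HH n) (b : HH m) : HH (n + m) :=
  cohom_class hoch_diff (hoch_cup (cohom_repr a) (cohom_repr b)).

Definition HH_one : HH 0 :=
  cohom_class hoch_diff ([ffun => 1] : hoch_cochain 0).

End Hochschild.

Section Centralizers.
Variables (k : fieldType) (gT : finGroupType).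
Local Notation G := [set: gT].
Local Notation kG := (grpalg k gT).

(* The i-th coset representative gamma_(i,x) is gamma x i, with i counted     *)
(* from 0.                                                                    *)
Definition coset_family := forall x : gT, 'I_#|(x ^: G)%g| -> gT.

Definition right_coset_reps (x : gT) (gam : 'I_#|(x ^: G)%g| -> gT) : Prop :=
  (forall i, val i = 0%N -> gam i = 1%g)
  /\ (forall g : gT, exists! i, g \in ('C[x] :* gam i)%g).

Definition centralizer_cochain (x : gT) n : vectType k :=
  cochain 'C[x]%G (k^o : vectType k) n.

Definition centralizer_cocycles (x : gT) n : {vspace centralizer_cochain x n} :=
  cocycles (@trivial_diff k gT 'C[x]%G) n.

Definition centralizer_class (x : gT) n (phi : centralizer_cochain x n) :
    group_cohom k 'C[x]%G n :=
  cohom_class (@trivial_diff k gT 'C[x]%G) phi.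

Definition hat (x : gT) n (phi : hoch_cochain k gT n) :
    centralizer_cochain x n :=
  [ffun t => let s := unbar t in
     gcoef ((-1) ^+ (n * n.+1)./2
              *: (gelt k (\prod_(h <- s) h)%g
                  * ceval phi (rev (map (fun h => h^-1)%g s)))) x].

Section Transversal.
Variable gamma : coset_family.

(* The index s and the element h of C_G(x) with gamma_i g = h gamma_s. The    *)
(* default i is never used when gamma x is a family of coset representatives. *)
Definition coset_step (x : gT) (i : 'I_#|(x ^: G)%g|) (g : gT) :
    'I_#|(x ^: G)%g| :=
  odflt i [pick s | (gamma i * g \in 'C[x] :* gamma s)%g].

Definition coset_elt (x : gT) (i : 'I_#|(x ^: G)%g|) (g : gT) : gT :=
  (gamma i * g * (gamma (coset_step i g))^-1)%g.

(* The sequence h'_(i,1), h'_(i,2), ... obtained from i and g_1, g_2, ...     *)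
Fixpoint coset_elts (x : gT) (i : 'I_#|(x ^: G)%g|) (s : seq gT) : seq gT :=
  if s is g :: s' then coset_elt i g :: coset_elts (coset_step i g) s'
  else [::].

Definition class_elt (x : gT) (i : 'I_#|(x ^: G)%g|) : gT :=
  ((gamma i)^-1 * x * gamma i)%g.

(* phi has degree n and is evaluated on h_(m+1), ..., h_(n+m), whereas psi is *)
(* evaluated on h_1, ..., h_m.                                                *)
Definition cup_component (x y z : gT) n m (phi : centralizer_cochain x n)
    (psi : centralizer_cochain y m) : centralizer_cochain z (n + m) :=
  [ffun t => let s := unbar t in
     let g := (\prod_(h <- take m s) h)%g in
     (-1) ^+ (n * m) *
     \sum_(ij : 'I_#|(x ^: G)%g| * 'I_#|(y ^: G)%g|
            | (g * class_elt ij.1 * g^-1 * class_elt ij.2 == z)%g)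
        ceval phi (coset_elts ij.1 (drop m s))
        * ceval psi (coset_elts ij.2 (take m s))].

Variable X : {set gT}.

Definition centralizer_sum n : lmodType k :=
  dsum (fun x : {x : gT | x \in X} => group_cohom k 'C[val x]%G n).

Definition cup_class (x y : gT) n m (a : group_cohom k 'C[x]%G n)
    (b : group_cohom k 'C[y]%G m) : centralizer_sum (n + m) :=
  dtuple (fun z : {x : gT | x \in X} =>
    centralizer_class (cup_component (val z) (cohom_repr a) (cohom_repr b))).

(* The bilinear extension of cup_class to the direct sums.                    *)
Definition centralizer_mul n m (a : centralizer_sum n) (b : centralizer_sum m) :
    centralizer_sum (n + m) :=
  \sum_x \sum_y cup_class (dproj a x) (dproj b y).

(* The class of the constant 1 in H^0(C_G(1), k).                             *)
Definition centralizer_one : centralizer_sum 0 :=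
  dtuple (fun x => centralizer_class [ffun => (val x == 1%g)%:R]).

Definition hat_iso n (c : HH k gT n) : centralizer_sum n :=
  dtuple (fun x => centralizer_class (hat (val x) (cohom_repr c))).

End Transversal.

End Centralizers.

(* Main.v *)
From HB Require Import structures.
Require Import Defs.
From mathcomp Require Import all_boot all_order all_algebra all_fingroup.
From mathcomp Require Import zify ring.

Set Implicit Arguments.
Unset Strict Implicit.
Unset Printing Implicit Defensive.

Import GRing.Theory.
Local Open Scope ring_scope.

(* After the substitution h_i = g_(n+1-i)^-1 and the twist by h_1 ... h_n,    *)
(* the Hochschild complex becomes the bar complex of G with coefficients in   *)
(* kG under conjugation (adj), and hat x restricts a cochain to C_G(x) and    *)
(* takes its coefficient at x. Spreading a cochain of C_G(x) over the class   *)
(* of x along the coset representatives gives a chain map ext, right inverse  *)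
(* to hat x, and cup_component z phi psi is hat z (ext phi \cup ext psi) on   *)
(* the nose. The endomorphism ext \o hat is homotopic to the identity because *)
(* the coset representatives are the components of a natural isomorphism      *)
(* between h |-> h' and h |-> h on the action groupoid of the class. Hence    *)
(* hat_iso is bijective and the product on the direct sum is the transported  *)
(* cup product, so its algebra axioms follow from those of HH^*(kG).          *)

(** The conjugation module kG is the sum over x in X of the modules k[C_x], each coinduced from the
    trivial module of C_G(x), so the theorem is Shapiro's lemma made explicit and multiplicative.
    [adj_diff] passes from the Hochschild complex to cochains of G with values in this module. There
    [hat] evaluates at x and restricts to C_G(x), [ext] goes back, and both are chain maps
    ([hat_chain], [ext_chain]). By [hat_ext] and [hat_ext_neq], [hat] inverts [ext] strictly,
    component by component. On cocycles the other composite is the identity up to a coboundary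
    ([ext_hat_homotopic]), by the prism identity [prism_homotopy].

    The product requires no homotopy. By [adj_cup] the coefficient of z in a cup product is a sum
    over pairs (u, v) with g u g^-1 v = z, and for extended cochains only u = x_i and v = y_j
    contribute, which gives the index set I_1 ([cup_componentE]). Hence the product on the direct
    sum is the cup product carried over by [hat_iso] ([centralizer_mulE]), and its axioms are those
    of HH^*(kG), where the cup product descends to cohomology by [hoch_cup_Leibniz]. *)

Section CochainValues.
Variables (k : fieldType) (gT : finGroupType) (H : {group gT}).
Variable V : vectType k.

Definition normalized (f : seq gT -> V) := forall s, 1%g \in s -> f s = 0.

Lemma unbar_onto n (s : seq gT) :
    size s = n -> {subset s <= H} -> 1%g \notin s ->
  exists t : n.-tuple (bar H), unbar t = s.
Proof.
move=> sz_s sH s1; have sH1 h : h \in s -> h \in H^#%g.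
  by move=> hs; rewrite !inE sH // andbT; apply: contraNneq s1 => <-.
have e : map val (pmap (insub : gT -> option (bar H)) s) = s.
  rewrite (pmap_filter (insubK _)); apply/all_filterP/allP => h /sH1 hH.
  by rewrite insubT.
have sz : size (pmap (insub : gT -> option (bar H)) s) == n.
  by rewrite -sz_s -[in X in _ == X]e size_map.
by exists (Tuple sz).
Qed.

(** Normalization of f matters because [ceval] returns 0 on sequences containing 1, whatever f gives
    there. *)
Lemma ceval_ffun n (f : seq gT -> V) s :
    size s = n -> {subset s <= H} -> normalized f ->
  ceval ([ffun t => f (unbar t)] : cochain H V n) s = f s.
Proof.
move=> sz_s sH nf; have [s1|s1] := boolP (1%g \in s).
  by rewrite ceval1 // nf.
by have [t <-] := unbar_onto sz_s sH s1; rewrite ceval_unbar ffunE.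
Qed.

Lemma ceval_inj n (phi psi : cochain H V n) :
    (forall s, size s = n -> {subset s <= H} -> 1%g \notin s ->
       ceval phi s = ceval psi s) ->
  phi = psi.
Proof.
move=> eq_pp; apply/ffunP => t; rewrite -!ceval_unbar eq_pp ?size_map ?size_tuple //.
  by move=> h /mapP[b _ ->]; have /setD1P[] := valP b.
by apply/mapP => -[b _ b1]; have := valP b; rewrite /= -b1 !inE eqxx.
Qed.

Lemma ceval_normalized n (phi : cochain H V n) : normalized (ceval phi).
Proof. by move=> s; apply: ceval1. Qed.

Lemma cevalB n (phi psi : cochain H V n) s :
  ceval (phi - psi) s = ceval phi s - ceval psi s.
Proof. by rewrite addrC -scaleN1r cevalP scaleN1r addrC. Qed.

Lemma ceval0 n s : ceval (0 : cochain H V n) s = 0.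
Proof. by rewrite -(subrr 0) cevalB subrr. Qed.

Lemma cevalD n (phi psi : cochain H V n) s :
  ceval (phi + psi) s = ceval phi s + ceval psi s.
Proof. by rewrite -[phi]scale1r cevalP !scale1r. Qed.

Lemma cevalZ n c (phi : cochain H V n) s : ceval (c *: phi) s = c *: ceval phi s.
Proof. by rewrite -[c *: phi]addr0 cevalP ceval0 addr0. Qed.

End CochainValues.

(** * The bar differential in recursive form *)

Section BarDifferential.
Variables (k : fieldType) (gT : finGroupType) (H : {group gT}).

(* The bar differential at h :: t without its first summand, which alone sees *)
(* the left action, in a recursive form suited to induction on t.             *)
Fixpoint bar_tail (V : zmodType) (ra : gT -> V -> V) (f : seq gT -> V) h t : V :=
  if t is h' :: t' then
    - f ((h * h')%g :: t') - bar_tail ra (fun u => f (h :: u)) h' t'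
  else - ra h (f [::]).

Definition seq_diff (V : zmodType) (la ra : gT -> V -> V) (f : seq gT -> V) s : V :=
  if s is h :: t then la h (f t) + bar_tail ra f h t else 0.

Lemma eq_in_bar_tail (D : {group gT}) (V : zmodType) (ra : gT -> V -> V) f f' h t :
    {subset h :: t <= D} ->
    (forall s, size s = size t -> {subset s <= D} -> f s = f' s) ->
  bar_tail ra f h t = bar_tail ra f' h t.
Proof.
elim: t h f f' => [|h' t IHt] h f f' /= sH eq_f; first by rewrite eq_f.
have [hD h'D] : h \in D /\ h' \in D by rewrite !sH ?inE ?eqxx ?orbT.
have tD : {subset t <= D} by move=> u tu; apply: sH; rewrite !inE tu !orbT.
rewrite eq_f //; last by move=> u; rewrite inE => /predU1P[->|/tD//]; rewrite groupM.
congr (_ - _); apply: IHt => [u|s sz_s sH'].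
  by rewrite inE => /predU1P[->|/tD].
by apply: eq_f => [|u]; rewrite /= ?sz_s // inE => /predU1P[->|/sH'].
Qed.

Lemma eq_bar_tail (V : zmodType) (ra : gT -> V -> V) f f' h t :
    (forall s, size s = size t -> f s = f' s) ->
  bar_tail ra f h t = bar_tail ra f' h t.
Proof.
move=> eq_f; apply: (@eq_in_bar_tail [set: gT]%G) => [u _|s sz_s _].
  by rewrite inE.
exact: eq_f.
Qed.

Lemma bar_tail_morph (V W : zmodType) (raV : gT -> V -> V) (raW : gT -> W -> W)
    (L : {additive V -> W}) f h t :
    (forall g v, L (raV g v) = raW g (L v)) ->
  bar_tail raW (fun s => L (f s)) h t = L (bar_tail raV f h t).
Proof.
move=> Lra; elim: t h f => [|h' t IHt] h f /=; first by rewrite raddfN Lra.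
by rewrite raddfB raddfN IHt.
Qed.

Section Linear.
Variables (V : vectType k) (la ra : gT -> {linear V -> V}).

Lemma bar_tailE (f : seq gT -> V) h t :
  bar_tail ra f h t =
    \sum_(1 <= i < (size t).+1) (-1) ^+ i *: f (bar_face i (h :: t))
    + (-1) ^+ (size t).+1 *: ra (last h t) (f (take (size t) (h :: t))).
Proof.
elim: t h f => [|h' t IHt] h f /=.
  by rewrite big_geq // add0r expr1 scaleN1r.
rewrite IHt big_nat_recl // expr1 scaleN1r /bar_face /= drop0 opprD addrA.
congr (_ + _ + _); last by rewrite -scaleNr -mulN1r -exprS.
rewrite -sumrN; apply: eq_big_nat => i /andP[i1 _].
by rewrite -scaleNr -mulN1r -exprS; case: i i1.
Qed.

Hypothesis la1 : forall v, la 1%g v = v.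
Hypothesis ra1 : forall v, ra 1%g v = v.

(** For nonempty t only the face that multiplies 1 into its right neighbour survives; the others
    keep the leading 1. *)
Lemma bar_tail1 f t : normalized f -> bar_tail ra f 1%g t = - f t.
Proof.
elim: t f => [|h t IHt] f nf /=; first by rewrite ra1.
rewrite mul1g (@eq_bar_tail _ _ _ (fun=> 0)); last first.
  by move=> s _; apply: nf; rewrite inE eqxx.
rewrite (_ : bar_tail _ _ _ _ = 0) ?subr0 //.
by elim: t h {IHt} => [|h' t IHt] h /=; rewrite ?linear0 ?IHt ?subrr ?oppr0.
Qed.

(** The two faces that merge a 1 with its left or right neighbour (or drop it, if it comes last)
    cancel; all others keep the 1. *)
Lemma bar_tail_normalized f h t :
  normalized f -> 1%g \in t -> bar_tail ra f h t = 0.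
Proof.
elim: t h f => [//|h' t IHt] h f nf; rewrite inE; have [<- _|_ /= t1] := eqVneq.
  rewrite /= mulg1 bar_tail1 ?opprK ?addNr // => s s1.
  by rewrite nf // inE s1 orbT.
rewrite nf ?inE ?t1 ?orbT // oppr0 add0r IHt ?oppr0 // => s s1.
by rewrite nf // inE s1 orbT.
Qed.

Lemma seq_diff_normalized f : normalized f -> normalized (seq_diff la ra f).
Proof.
move=> nf [//|h t]; rewrite inE /=; have [<- _|_ /= t1] := eqVneq.
  by rewrite la1 bar_tail1 // subrr.
by rewrite nf // linear0 bar_tail_normalized // addr0.
Qed.

(** At sequences containing 1 both sides vanish, by [seq_diff_normalized], so later computations
    need no case distinction on such sequences. *)
Lemma ceval_bar_diff n (phi : cochain H V n) s :
    size s = n.+1 -> {subset s <= H} ->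
  ceval (bar_diff la ra phi) s = seq_diff la ra (ceval phi) s.
Proof.
move=> sz_s sH; have [s1|s1] := boolP (1%g \in s).
  by rewrite ceval1 // seq_diff_normalized //; apply: ceval_normalized.
have [t def_s] := unbar_onto sz_s sH s1.
rewrite -{1}def_s ceval_unbar ffunE /= def_s.
by case: s sz_s {sH s1 def_s} => [//|h s] [sz_s] /=; rewrite bar_tailE sz_s addrA.
Qed.

End Linear.
End BarDifferential.

(** * Cohomology classes and chain maps *)

Section CohomologyClasses.
Variables (k : fieldType) (C : nat -> vectType k).
Variable d : forall n, {linear C n -> C n.+1}.

Lemma mem_cocycles n (a : C n) : (a \in cocycles d n) = (d n a == 0).
Proof. by rewrite memv_ker lfunE. Qed.

Lemma mem_coboundariesS n (a : C n.+1) :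
  reflect (exists b, a = d n b) (a \in coboundaries d n.+1).
Proof.
apply: (iffP memv_imgP) => [[b _ ->]|[b ->]].
  by exists b; rewrite lfunE.
by exists b; rewrite ?memvf ?lfunE.
Qed.

Lemma cohom_classP n (a b : C n) : a \in cocycles d n -> b \in cocycles d n ->
  cohom_class d a = cohom_class d b <-> a - b \in coboundaries d n.
Proof.
move=> Za Zb; rewrite /cohom_class vquot_piP -memv_preim lfunE raddfB /=.
by rewrite !vsprojK.
Qed.

Lemma cohom_reprK n (c : cohom d n) : cohom_class d (cohom_repr c) = c.
Proof. by rewrite /cohom_class /cohom_repr vsvalK vquot_reprK. Qed.

Lemma cohom_repr_cocycle n (c : cohom d n) : cohom_repr c \in cocycles d n.
Proof. exact: subvsP. Qed.

(** [vsproj] is linear on all of C n, so no cocycle hypothesis appears. *)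
Lemma cohom_class_linear n : linear (@cohom_class k C d n).
Proof.
move=> c a b; rewrite /cohom_class linearP /= vquot_piD; congr (_ + _).
by rewrite -vquot_piZ.
Qed.

HB.instance Definition _ n :=
  GRing.isLinear.Build k (C n) (cohom d n) *:%R (@cohom_class k C d n)
    (@cohom_class_linear n).

Lemma cohom_repr_class n (a : C n) : a \in cocycles d n ->
  cohom_repr (cohom_class d a) - a \in coboundaries d n.
Proof.
by move=> Za; apply/cohom_classP; rewrite ?cohom_repr_cocycle ?cohom_reprK.
Qed.

End CohomologyClasses.

Section ChainMap.
Variables (k : fieldType) (C C' : nat -> vectType k).
Variables (d : forall n, {linear C n -> C n.+1}).
Variables (d' : forall n, {linear C' n -> C' n.+1}).
Variable F : forall n, {linear C n -> C' n}.
Hypothesis F_chain : forall n a, F n.+1 (d n a) = d' n (F n a).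

Lemma chain_map_cocycle n a : a \in cocycles d n -> F n a \in cocycles d' n.
Proof. by rewrite !mem_cocycles -F_chain => /eqP->; rewrite linear0. Qed.

Lemma chain_map_coboundary n a :
  a \in coboundaries d n -> F n a \in coboundaries d' n.
Proof.
case: n a => [|n] a; first by rewrite !memv0 => /eqP->; rewrite linear0.
move=> /mem_coboundariesS[b ->]; apply/mem_coboundariesS.
by exists (F n b); rewrite F_chain.
Qed.

(** Independence of the representative chosen by [cohom_repr]. *)
Lemma chain_map_class n a : a \in cocycles d n ->
  cohom_class d' (F n (cohom_repr (cohom_class d a))) = cohom_class d' (F n a).
Proof.
move=> Za; apply/cohom_classP; rewrite ?chain_map_cocycle ?cohom_repr_cocycle //.
by rewrite -linearB chain_map_coboundary // cohom_repr_class.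
Qed.

Lemma chain_map_class_linear n :
  linear (fun c : cohom d n => cohom_class d' (F n (cohom_repr c))).
Proof.
move=> a u v; rewrite -[u in LHS]cohom_reprK -[v in LHS]cohom_reprK.
rewrite -linearP chain_map_class ?linearP //.
by rewrite rpredD ?rpredZ ?cohom_repr_cocycle.
Qed.

End ChainMap.

(** * Hochschild cochains and the Leibniz rule *)

Section Hochschild.
Variables (k : fieldType) (gT : finGroupType).
Local Notation kG := (grpalg k gT).
Local Notation G := [set: gT]%G.
Local Notation hoch := (hoch_cochain k gT).
Local Notation d := (hoch_diff k gT).

Lemma gelt1 : gelt k (1%g : gT) = 1.
Proof. by []. Qed.

Lemma gcoef_geltl g (a : kG) u : gcoef (gelt k g * a) u = gcoef a (g^-1 * u)%g.
Proof.
rewrite gcoefM (bigD1 g) //= big1 => [|v vg]; last by rewrite geltE (negPf vg) mul0r.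
by rewrite geltE eqxx mul1r addr0.
Qed.

Lemma gcoef_geltr g (a : kG) u : gcoef (a * gelt k g) u = gcoef a (u * g^-1)%g.
Proof.
rewrite gcoefM (bigD1 (u * g^-1)%g) //= big1 => [|v vg].
  by rewrite geltE invMg invgK mulgKV eqxx mulr1 addr0.
rewrite geltE (_ : _ == g = false) ?mulr0 //.
by apply: contraNF vg => /eqP<-; rewrite invMg invgK mulKVg.
Qed.

Definition hoch_la (g : gT) : kG -> kG := fun a => gelt k g * a.
Definition hoch_ra (g : gT) : kG -> kG := fun a => a * gelt k g.
Definition hoch_seq_diff := seq_diff hoch_la hoch_ra.

Lemma subsetG (s : seq gT) : {subset s <= G}.
Proof. by move=> h _; rewrite inE. Qed.

Lemma ceval_hoch_diff n (phi : hoch n) s : size s = n.+1 ->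
  ceval (d n phi) s = hoch_seq_diff (ceval phi) s.
Proof.
move=> sz_s; apply: ceval_bar_diff => //; last exact: subsetG.
  by move=> v; rewrite /= gelt1 mul1r.
by move=> v; rewrite /= gelt1 mulr1.
Qed.

(** The last summand for f multiplies on the right by a group element, the first summand for g
    multiplies on the left by the same element, and the two cancel. This is the case n = 0; the
    induction step moves one argument into f. *)
Lemma bar_tail_cup (f g : seq gT -> kG) n h t : (n <= size t)%N ->
  bar_tail hoch_ra (fun s => f (take n s) * g (drop n s)) h t
  = bar_tail hoch_ra f h (take n t) * g (drop n t)
    + (-1) ^+ n * (f (take n (h :: t)) * hoch_seq_diff g (drop n (h :: t))).
Proof.
elim: n h t f => [|n IHn] h t f.
  rewrite take0 !drop0 expr0 mul1r /= /hoch_la => _.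
  rewrite (@eq_bar_tail _ _ _ _ (fun s => f [::] * g s)); last first.
    by move=> s _; rewrite take0 drop0.
  have -> : bar_tail hoch_ra (fun s => f [::] * g s) h t
      = f [::] * bar_tail hoch_ra g h t.
    apply: (@bar_tail_morph _ kG kG hoch_ra hoch_ra (f [::] \*o idfun)) => u v.
    by rewrite /hoch_ra /= mulrA.
  by rewrite mulrDr addrA mulNr /hoch_ra mulrA addNr add0r.
case: t => [//|h' t] /= nt; rewrite (IHn h' t (fun u => f (h :: u))) //.
by rewrite opprD addrA mulrDl !mulNr exprS mulN1r mulNr.
Qed.

Lemma hoch_cup_normalized n m (phi : hoch n) (psi : hoch m) :
  normalized (fun s => ceval phi (take n s) * ceval psi (drop n s)).
Proof.
move=> s; rewrite -{1}(cat_take_drop n s) mem_cat => /orP[] /ceval1->.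
  by rewrite mul0r.
by rewrite mulr0.
Qed.

Lemma ceval_hoch_cup n m (phi : hoch n) (psi : hoch m) s : size s = (n + m)%N ->
  ceval (hoch_cup phi psi) s = ceval phi (take n s) * ceval psi (drop n s).
Proof.
move=> sz_s; pose f s := ceval phi (take n s) * ceval psi (drop n s).
apply: (@ceval_ffun _ _ _ _ _ f) => //; first exact: subsetG.
exact: hoch_cup_normalized.
Qed.

(** Stated on values because [n + m.+1] is not convertible to [(n + m).+1]. *)
Lemma hoch_cup_Leibniz n m (phi : hoch n) (psi : hoch m) s :
    size s = (n + m).+1 ->
  ceval (d _ (hoch_cup phi psi)) s =
    ceval (d n phi) (take n.+1 s) * ceval psi (drop n.+1 s)
    + (-1) ^+ n * (ceval phi (take n s) * ceval (d m psi) (drop n s)).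
Proof.
case: s => [//|h t] [sz_t]; rewrite !ceval_hoch_diff /= ?sz_t //; first last.
- by rewrite size_takel // sz_t leq_addr.
- by rewrite size_drop /= sz_t subSn ?leq_addr ?addKn.
rewrite (@eq_bar_tail _ _ _ _ (fun s => ceval phi (take n s) * ceval psi (drop n s))).
  rewrite bar_tail_cup ?sz_t ?leq_addr //.
  by rewrite mulrDl addrA /hoch_la ceval_hoch_cup // mulrA.
by move=> s sz_s; rewrite ceval_hoch_cup // sz_s.
Qed.

Lemma hoch_cup_cocycle n m (phi : hoch n) (psi : hoch m) :
    phi \in cocycles d n -> psi \in cocycles d m ->
  hoch_cup phi psi \in cocycles d (n + m).
Proof.
rewrite !mem_cocycles => /eqP dphi /eqP dpsi; apply/eqP/ceval_inj => s sz_s _ _.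
by rewrite hoch_cup_Leibniz // dphi dpsi !ceval0 mul0r !mulr0 addr0.
Qed.

(* The degree equation allows N = n + m.+1, not convertible to (n + m).+1.    *)
Lemma hoch_coboundary_ceval N M (a : hoch N) (b : hoch M) :
    M.+1 = N -> (forall s, size s = N -> ceval a s = ceval (d M b) s) ->
  a \in coboundaries d N.
Proof.
move=> e; case: N / e a => a eq_ab; apply/mem_coboundariesS; exists b.
by apply: ceval_inj => s sz_s _ _; apply: eq_ab.
Qed.

Lemma hoch_cup_coboundaryl n m (phi : hoch n) (psi : hoch m) :
    phi \in coboundaries d n -> psi \in cocycles d m ->
  hoch_cup phi psi \in coboundaries d (n + m).
Proof.
case: n phi => [|n] phi.
  rewrite memv0 => /eqP-> _; rewrite (_ : hoch_cup _ _ = 0) ?mem0v //.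
  by apply: ceval_inj => s sz_s _ _; rewrite ceval_hoch_cup // !ceval0 mul0r.
move=> /mem_coboundariesS[b ->]; rewrite mem_cocycles => /eqP dpsi.
apply: (@hoch_coboundary_ceval _ (n + m) _ (hoch_cup b psi)) => // s sz_s.
by rewrite hoch_cup_Leibniz // dpsi ceval0 !mulr0 addr0 ceval_hoch_cup.
Qed.

Lemma hoch_cup_coboundaryr n m (phi : hoch n) (psi : hoch m) :
    phi \in cocycles d n -> psi \in coboundaries d m ->
  hoch_cup phi psi \in coboundaries d (n + m).
Proof.
case: m psi => [|m] psi.
  rewrite memv0 => _ /eqP->; rewrite (_ : hoch_cup _ _ = 0) ?mem0v //.
  by apply: ceval_inj => s sz_s _ _; rewrite ceval_hoch_cup // !ceval0 mulr0.
rewrite mem_cocycles => /eqP dphi /mem_coboundariesS[b ->].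
(* The factor (-1)^n undoes the sign of the second summand in the Leibniz rule. *)
apply: (@hoch_coboundary_ceval _ (n + m) _ ((-1) ^+ n *: hoch_cup phi b)).
  by rewrite addnS.
move=> s sz_s; rewrite linearZ cevalZ hoch_cup_Leibniz ?sz_s ?addnS //.
rewrite dphi ceval0 mul0r add0r ceval_hoch_cup //.
rewrite -(signr_odd k) -(signr_odd (grpalg k gT)).
by case: odd; rewrite ?scaleN1r ?mulN1r ?opprK ?scale1r ?mul1r.
Qed.

End Hochschild.

(** * The graded algebra HH^*(kG) *)

Section HochschildAlgebra.
Variables (k : fieldType) (gT : finGroupType).
Local Notation hoch := (hoch_cochain k gT).
Local Notation d := (hoch_diff k gT).

Lemma hoch_cup_linearl n m (psi : hoch m) :
  linear (fun phi : hoch n => hoch_cup phi psi).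
Proof.
move=> a phi phi'; apply: ceval_inj => s sz_s _ _.
by rewrite cevalD cevalZ !ceval_hoch_cup // cevalD cevalZ mulrDl scalerAl.
Qed.

Lemma hoch_cup_linearr n m (phi : hoch n) : linear (@hoch_cup k gT n m phi).
Proof.
move=> a psi psi'; apply: ceval_inj => s sz_s _ _.
by rewrite cevalD cevalZ !ceval_hoch_cup // cevalD cevalZ mulrDr scalerAr.
Qed.

Lemma hoch_cupB n m (phi phi' : hoch n) (psi psi' : hoch m) :
  hoch_cup phi psi - hoch_cup phi' psi'
  = hoch_cup (phi - phi') psi + hoch_cup phi' (psi - psi').
Proof.
apply: ceval_inj => s sz_s _ _.
rewrite cevalB cevalD !ceval_hoch_cup // !cevalB mulrBl mulrBr.
by rewrite addrA addrNK.
Qed.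

Lemma HH_mulE n m (phi : hoch n) (psi : hoch m) :
    phi \in cocycles d n -> psi \in cocycles d m ->
  HH_mul (cohom_class d phi) (cohom_class d psi)
  = cohom_class d (hoch_cup phi psi).
Proof.
move=> Zphi Zpsi; apply/cohom_classP; rewrite ?hoch_cup_cocycle ?cohom_repr_cocycle //.
rewrite hoch_cupB; apply: rpredD.
  exact: hoch_cup_coboundaryl (cohom_repr_class Zphi) (cohom_repr_cocycle _).
exact: hoch_cup_coboundaryr Zphi (cohom_repr_class Zpsi).
Qed.

(** Evaluation at a sequence does not see the form of the degree, so laws that involve a cast reduce
    to equalities of values. *)
Lemma deg_cast_HH N M (e : N = M) (a : hoch N) (b : hoch M) :
    (forall s, size s = M -> ceval a s = ceval b s) ->
  deg_cast (A := HH k gT) e (cohom_class d a) = cohom_class d b.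
Proof.
case: M / e b => b eq_ab; congr (cohom_class _ _).
by apply: ceval_inj => s sz_s _ _; apply: eq_ab.
Qed.

Definition hoch_one : hoch 0 := [ffun => 1].

Lemma ceval_hoch_one : ceval hoch_one [::] = 1.
Proof. by have := ceval_unbar hoch_one [tuple]; rewrite ffunE => <-. Qed.

Lemma hoch_one_cocycle : hoch_one \in cocycles d 0.
Proof.
rewrite mem_cocycles; apply/eqP/ceval_inj => -[//|h []] // _ _ _.
rewrite ceval_hoch_diff //= /hoch_la /hoch_ra ceval_hoch_one.
by rewrite mulr1 mul1r subrr ceval0.
Qed.

Lemma HH_ex n (c : HH k gT n) :
  exists2 phi, phi \in cocycles d n & c = cohom_class d phi.
Proof.
by exists (cohom_repr c); rewrite ?cohom_repr_cocycle ?cohom_reprK.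
Qed.

Lemma HH_graded_algebra : graded_algebra (@HH_mul k gT) (HH_one k gT).
Proof.
split=> [n m b | n m a | n m p a b c | n a | n a].
- have [psi Zpsi ->] := HH_ex b.
  move=> c a a'; have [phi Zphi ->] := HH_ex a; have [phi' Zphi' ->] := HH_ex a'.
  rewrite -linearP !HH_mulE ?rpredD ?rpredZ //.
  by rewrite -linearP; congr cohom_class; apply: hoch_cup_linearl.
- have [phi Zphi ->] := HH_ex a.
  move=> c b b'; have [psi Zpsi ->] := HH_ex b; have [psi' Zpsi' ->] := HH_ex b'.
  rewrite -linearP !HH_mulE ?rpredD ?rpredZ //.
  by rewrite -linearP; congr cohom_class; apply: hoch_cup_linearr.
- have [phi Zphi ->] := HH_ex a; have [psi Zpsi ->] := HH_ex b.
  have [chi Zchi ->] := HH_ex c.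
  rewrite !HH_mulE ?hoch_cup_cocycle //; apply: deg_cast_HH => s sz_s.
  rewrite !ceval_hoch_cup ?size_drop ?size_takel ?sz_s //; try lia.
  by rewrite mulrA drop_drop take_drop take_takel ?leq_addr // (addnC m n).
- have [phi Zphi ->] := HH_ex a; rewrite HH_mulE ?hoch_one_cocycle //.
  apply: deg_cast_HH => s sz_s.
  by rewrite ceval_hoch_cup // take0 drop0 ceval_hoch_one mul1r.
- have [phi Zphi ->] := HH_ex a; rewrite HH_mulE ?hoch_one_cocycle //.
  apply: deg_cast_HH => s sz_s.
  rewrite ceval_hoch_cup ?sz_s ?addn0 // take_oversize ?drop_oversize ?sz_s //.
  by rewrite ceval_hoch_one mulr1.
Qed.

End HochschildAlgebra.

(** * From Hochschild cochains to cochains with values in the conjugation module *)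

Section Adjoint.
Variables (k : fieldType) (gT : finGroupType).
Local Notation kG := (grpalg k gT).
Local Notation hoch := (hoch_cochain k gT).
Local Notation d := (hoch_diff k gT).

Definition rev_inv (s : seq gT) : seq gT := rev (map (fun h => h^-1)%g s).

Lemma rev_invK : involutive rev_inv.
Proof. by move=> s; rewrite /rev_inv map_rev revK (mapK invgK). Qed.

Lemma size_rev_inv s : size (rev_inv s) = size s.
Proof. by rewrite size_rev size_map. Qed.

Lemma rev_inv_cat s1 s2 : rev_inv (s1 ++ s2) = rev_inv s2 ++ rev_inv s1.
Proof. by rewrite /rev_inv map_cat rev_cat. Qed.

Lemma rev_inv_cons h s : rev_inv (h :: s) = rcons (rev_inv s) h^-1%g.
Proof. by rewrite /rev_inv map_cons rev_cons. Qed.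

Lemma rev_inv_rcons s h : rev_inv (rcons s h) = h^-1%g :: rev_inv s.
Proof. by rewrite /rev_inv map_rcons rev_rcons. Qed.

Lemma mem1_rev_inv s : (1%g \in rev_inv s) = (1%g \in s).
Proof. by rewrite mem_rev -[X in X \in _]invg1 mem_map //; apply: invg_inj. Qed.

Lemma bar_face_cat (s1 s2 : seq gT) a b :
  bar_face (size s1).+1 (s1 ++ [:: a, b & s2]) = s1 ++ (a * b)%g :: s2.
Proof.
rewrite /bar_face /= take_size_cat // !nth_cat drop_cat ltnn subnn.
by rewrite !ltnNge leqnSn ltnW //= subSnn subSn // subSnn /= ?drop0.
Qed.

Lemma bar_face_split i (s : seq gT) : (0 < i < size s)%N ->
  exists s1 a b s2, s = s1 ++ [:: a, b & s2] /\ i = (size s1).+1.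
Proof.
case: i => [//|i] /andP[_ lt_i]; exists (take i s), (nth 1 s i)%g, (nth 1 s i.+1)%g.
exists (drop i.+2 s); rewrite -!drop_nth ?(ltnW lt_i) // cat_take_drop.
by rewrite size_takel // ltnW // ltnW.
Qed.

(** Inversion is an anti-automorphism, so products of neighbours remain products of neighbours,
    counted from the other end. *)
Lemma bar_face_rev_inv i s : (0 < i < size s)%N ->
  bar_face i (rev_inv s) = rev_inv (bar_face (size s - i) s).
Proof.
move=> lt_i; have [|s1 [a [b [s2 [def_s def_i]]]]] := @bar_face_split (size s - i) s.
  lia.
rewrite def_i; have -> : i = (size (rev_inv s2)).+1.
  by move: def_i lt_i; rewrite size_rev_inv def_s size_cat /=; lia.
rewrite def_s bar_face_cat !rev_inv_cat !rev_inv_cons !cat_rcons.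
by rewrite bar_face_cat invMg.
Qed.

Lemma prod_bar_face i (s : seq gT) : (0 < i < size s)%N ->
  (\prod_(h <- bar_face i s) h = \prod_(h <- s) h)%g.
Proof.
move=> /bar_face_split[s1 [a [b [s2 [-> ->]]]]]; rewrite bar_face_cat.
by rewrite !big_cat !big_cons /= -!mulgA.
Qed.

Lemma prod_rev_inv (s : seq gT) : (\prod_(h <- rev_inv s) h = (\prod_(h <- s) h)^-1)%g.
Proof.
elim: s => [|h s IHs]; first by rewrite !big_nil invg1.
by rewrite rev_inv_cons big_rcons big_cons IHs invMg.
Qed.

Definition adj_sign n : k := (-1) ^+ (n * n.+1)./2.

Lemma adj_signS n : adj_sign n.+1 = (-1) ^+ n.+1 * adj_sign n.
Proof. by rewrite -exprD; congr (_ ^+ _); lia. Qed.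

(** The origin of the sign (-1)^(nm) in the product formula. *)
Lemma adj_signD n m : adj_sign (n + m) = (-1) ^+ (n * m) * adj_sign n * adj_sign m.
Proof.
rewrite -!exprD; congr (_ ^+ _).
elim: m => [|m IHm]; first by rewrite muln0 addn0 addn0.
have half_S p : ((p.+1 * p.+2)./2 = (p * p.+1)./2 + p.+1)%N by lia.
by rewrite addnS !half_S IHm mulnS; lia.
Qed.

Lemma adj_signK n a : adj_sign n * (adj_sign n * a) = a.
Proof. exact: signrMK. Qed.

(* hat x phi is the restriction of adj phi x to C_G(x); adj_diff says that    *)
(* adj turns the Hochschild complex into the bar complex of G with values in  *)
(* kG under conjugation.                                                      *)
Definition adj n (phi : hoch n) (u : gT) (s : seq gT) : k :=
  adj_sign n * gcoef (ceval phi (rev_inv s)) ((\prod_(h <- s) h)^-1 * u)%g.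

(** The formula of [adj] solved for the cochain; it serves to build a Hochschild cochain with
    prescribed coefficients. *)
Definition unadj n (f : gT -> seq gT -> k) : hoch n :=
  [ffun t => let s := unbar t in
     [ffun v => adj_sign n * f ((\prod_(h <- s) h)^-1 * v)%g (rev_inv s) : k^o]
     : kG].

Lemma adj_normalized n (phi : hoch n) u s : 1%g \in s -> adj phi u s = 0.
Proof.
by move=> s1; rewrite /adj ceval1 ?mem1_rev_inv // /gcoef ffunE mulr0.
Qed.

Lemma adj_linear n u s : linear (fun phi : hoch n => adj phi u s : k^o).
Proof.
move=> a phi psi; rewrite /adj cevalP gcoefD gcoefZ mulrDr.
by congr (_ + _); rewrite mulrCA.
Qed.

Lemma adj_unadj n f u s : (forall v t, 1%g \in t -> f v t = 0) -> size s = n ->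
  adj (unadj n f) u s = f u s.
Proof.
move=> nf sz_s; rewrite /adj /unadj.
pose F s : kG :=
  [ffun v => adj_sign n * f ((\prod_(h <- s) h)^-1 * v)%g (rev_inv s) : k^o].
rewrite (@ceval_ffun _ _ _ _ n F) ?size_rev_inv //; last 2 first.
- exact: subsetG.
- move=> t t1; apply: gcoefP => v; rewrite /gcoef !ffunE nf ?mulr0 //.
  by rewrite mem1_rev_inv.
by rewrite /gcoef ffunE adj_signK rev_invK prod_rev_inv invgK mulKVg.
Qed.

Lemma adj_inj n (phi psi : hoch n) :
  (forall u s, size s = n -> adj phi u s = adj psi u s) -> phi = psi.
Proof.
move=> eq_pp; apply: ceval_inj => s sz_s _ _; apply: gcoefP => v.
have := eq_pp ((\prod_(h <- rev_inv s) h) * v)%g (rev_inv s).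
rewrite size_rev_inv /adj mulKg rev_invK => /(_ sz_s) eq_v.
by rewrite -[LHS](adj_signK n) eq_v adj_signK.
Qed.

Definition trivial_tail (f : seq gT -> k) := bar_tail (fun _ (a : k) => a) f.

Lemma trivial_tailE f h t :
  trivial_tail f h t =
    \sum_(1 <= i < (size t).+1) (-1) ^+ i * f (bar_face i (h :: t))
    + (-1) ^+ (size t).+1 * f (take (size t) (h :: t)).
Proof. exact: (@bar_tailE _ _ k^o (fun=> idfun)). Qed.

Lemma gcoef_sum (I : Type) (r : seq I) (P : pred I) (F : I -> kG) v :
  gcoef (\sum_(i <- r | P i) F i) v = \sum_(i <- r | P i) gcoef (F i) v.
Proof.
by apply: (big_morph (fun a => gcoef a v)) => [a b|]; rewrite /gcoef !ffunE.
Qed.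

Lemma take_belast (h : gT) t : take (size t) (h :: t) = belast h t.
Proof. by rewrite lastI -cats1 -(size_belast h t) take_size_cat. Qed.

Lemma ceval_hoch_diffE n (phi : hoch n) s : size s = n.+1 ->
  ceval (d n phi) s = gelt k (head 1%g s) * ceval phi (behead s)
    + (\sum_(1 <= i < n.+1) (-1) ^+ i *: ceval phi (bar_face i s)
    + (-1) ^+ n.+1 *: (ceval phi (take n s) * gelt k (last 1%g s))).
Proof.
case: s => [//|h t] [sz_t]; rewrite ceval_hoch_diff /= ?sz_t //.
by rewrite (@bar_tailE k gT kG (fun g : gT => gelt k g \o* idfun)) sz_t.
Qed.

Lemma adj_diff n (phi : hoch n) u h t : size t = n ->
  adj (d n phi) u (h :: t) = adj phi (u ^ h) t + trivial_tail (adj phi u) h t.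
Proof.
move=> sz_t; have sz_s : size (rev_inv (h :: t)) = n.+1 by rewrite size_rev_inv /= sz_t.
rewrite trivial_tailE sz_t {1}/adj ceval_hoch_diffE // !gcoefD gcoef_sum !mulrDr.
(* Reversal exchanges the outer summands: right multiplication by h^-1 yields the conjugation action
   on u, while left multiplication by the inverse of the last argument is absorbed by the twist. *)
rewrite [LHS]addrC -[LHS]addrA [LHS]addrCA; congr (_ + (_ + _)).
- rewrite rev_inv_cons -cats1 take_size_cat ?size_rev_inv // cats1 last_rcons.
  rewrite gcoefZ gcoef_geltr adj_signS -mulrA mulrCA signrMK.
  by rewrite big_cons invMg invgK /adj conjgE !mulgA.
- rewrite mulr_sumr big_nat_rev /=; apply: eq_big_nat => i lt_i.
  rewrite gcoefZ bar_face_rev_inv /= ?sz_t; last lia.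
  rewrite add1n subSS subKn; last lia.
  rewrite /adj prod_bar_face; last by rewrite /= sz_t.
  have sgn : (-1) ^+ n.+1 = (-1) ^+ (n.+1 - i) * (-1) ^+ i :> k.
    by rewrite -exprD subnK //; lia.
  rewrite adj_signS sgn -!mulrA [LHS]mulrCA; congr (_ * _).
  by rewrite [LHS]mulrCA signrMK.
- have tE : take n (h :: t) = belast h t by rewrite -sz_t take_belast.
  rewrite tE /adj (lastI h t) rev_inv_rcons /= gcoef_geltl big_rcons /=.
  by rewrite invMg invgK !mulgA mulgV mul1g adj_signS mulrA.
Qed.

(** Reversal gives phi the last n arguments and psi the first m, and the twist by g conjugates the
    first factor of the convolution in kG. *)
Lemma adj_cup n m (phi : hoch n) (psi : hoch m) z s : size s = (n + m)%N ->
  let g := (\prod_(h <- take m s) h)%g in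
  adj (hoch_cup phi psi) z s
  = (-1) ^+ (n * m) *
    \sum_u adj phi u (drop m s) * adj psi (g * u^-1 * g^-1 * z)%g (take m s).
Proof.
move=> sz_s g; rewrite /adj ceval_hoch_cup ?size_rev_inv //.
have sz_d : size (rev_inv (drop m s)) = n by rewrite size_rev_inv size_drop sz_s addnK.
rewrite -[in rev_inv s](cat_take_drop m s) rev_inv_cat take_size_cat // drop_size_cat //.
have -> : (\prod_(h <- s) h = g * \prod_(h <- drop m s) h)%g.
  by rewrite -big_cat cat_take_drop.
rewrite gcoefM adj_signD -!mulrA -/g; congr (_ * _); rewrite !mulr_sumr.
set pd := (\prod_(h <- drop m s) h)%g.
(* The translation by pd^-1 is the twist contained in [adj phi u (drop m s)]. *)
rewrite (reindex_inj (mulgI pd^-1)%g) /=; apply: eq_bigr => u _.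
rewrite -!mulrA; congr (_ * _); rewrite mulrCA; congr (_ * (_ * _)).
by congr gcoef; rewrite !invMg invgK !mulgA mulgK mulVg mul1g.
Qed.

End Adjoint.

(** * The action of G on coset indices *)

Section Cosets.
Variables (gT : finGroupType) (gamma : coset_family gT) (x : gT).
Hypothesis reps : right_coset_reps (@gamma x).
Local Notation step := (@coset_step gT gamma x).
Local Notation elt := (@coset_elt gT gamma x).
Local Notation elts := (@coset_elts gT gamma x).
Local Notation conj := (@class_elt gT gamma x).
Implicit Types (i : 'I_#|(x ^: [set: gT])%g|) (g h : gT).

Lemma coset_elt_cent i g : elt i g \in 'C[x]%g.
Proof.
rewrite /coset_elt -mem_rcoset /coset_step; case: pickP => //= no_s.
(* The default of [coset_step] is never reached: some coset contains gamma i * g. *)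
by have [s [gs _]] := reps.2 (gamma i * g)%g; rewrite no_s in gs.
Qed.

Lemma coset_eltE i g : (elt i g * gamma (step i g) = gamma i * g)%g.
Proof. by rewrite mulgKV. Qed.

Lemma coset_step_eq i g s h :
  h \in 'C[x]%g -> (gamma i * g = h * gamma s)%g -> step i g = s.
Proof.
move=> hC eq_g; have [j [_ j_uniq]] := reps.2 (gamma i * g)%g.
rewrite -(j_uniq s); last by rewrite mem_rcoset eq_g mulgK.
by rewrite (j_uniq (step i g)) // mem_rcoset -/(elt i g) coset_elt_cent.
Qed.

Lemma coset_step1 i : step i 1%g = i.
Proof. by apply: (@coset_step_eq _ _ _ 1%g); rewrite ?group1 // mulg1 mul1g. Qed.

Lemma coset_elt1 i : elt i 1%g = 1%g.
Proof. by rewrite /coset_elt coset_step1 mulg1 mulgV. Qed.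

Lemma coset_stepM i g h : step i (g * h)%g = step (step i g) h.
Proof.
apply: (@coset_step_eq _ _ _ (elt i g * elt (step i g) h)%g).
  by rewrite groupM ?coset_elt_cent.
by rewrite /coset_elt !mulgA !mulgKV.
Qed.

(** With [coset_elt1], this makes (i, g) |-> h a functor from the action groupoid of the class of x
    to C_G(x). *)
Lemma coset_eltM i g h : elt i (g * h)%g = (elt i g * elt (step i g) h)%g.
Proof. by rewrite /coset_elt coset_stepM !mulgA mulgKV. Qed.

Lemma coset_step_inj g : injective (step^~ g).
Proof.
by move=> i j /(congr1 (step^~ g^-1%g)); rewrite -!coset_stepM mulgV !coset_step1.
Qed.

Lemma class_eltE i : conj i = (x ^ gamma i)%g.
Proof. by rewrite conjgE mulgA. Qed.

Lemma conjg_cent h : h \in 'C[x]%g -> (x ^ h)%g = x.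
Proof. by move=> /cent1P xh; rewrite conjgE -xh mulKg. Qed.

(** Since [elt i g] centralizes x, the action on indices is the conjugation action on the class. *)
Lemma class_elt_step i g : conj (step i g) = (conj i ^ g)%g.
Proof.
rewrite !class_eltE -[X in (X ^ _ = _)%g](conjg_cent (coset_elt_cent i g)).
by rewrite !conjgE !mulgA /coset_elt !invMg !invgK !mulgA !mulgKV mulVg mul1g.
Qed.

Lemma class_elt_inj : injective conj.
Proof.
move=> i j; rewrite !class_eltE => eq_ij.
rewrite -(coset_step1 i); apply: (@coset_step_eq _ _ _ (gamma i * (gamma j)^-1)%g).
  have xij : (x ^ (gamma i * (gamma j)^-1) = x)%g.
    by rewrite conjgM eq_ij -conjgM mulgV conjg1.
  by rewrite cent1C; apply/cent1P/commgP/conjg_fixP.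
by rewrite mulgKV mulg1.
Qed.

Lemma class_elt_onto g : exists i, conj i = (x ^ g)%g.
Proof.
have [i [gi _]] := reps.2 g; exists i.
move: gi; rewrite mem_rcoset class_eltE => /conjg_cent xg.
by rewrite -[X in (X ^ _ = _)%g]xg -conjgM mulgKV.
Qed.

Lemma coset_elts_cent i s : {subset elts i s <= 'C[x]%g}.
Proof.
elim: s i => [//|g s IHs] i h /=; rewrite inE => /predU1P[->|/IHs //].
exact: coset_elt_cent.
Qed.

Lemma size_coset_elts i s : size (elts i s) = size s.
Proof. by elim: s i => //= g s IHs i; rewrite IHs. Qed.

Lemma mem1_coset_elts i s : 1%g \in s -> 1%g \in elts i s.
Proof.
elim: s i => [//|g s IHs] i /=; rewrite !inE => /orP[/eqP<-|/IHs->].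
  by rewrite coset_elt1 eqxx.
by rewrite orbT.
Qed.

Lemma coset_unit_index : exists i0, gamma i0 = 1%g :> gT.
Proof.
have n_gt0 : (0 < #|(x ^: [set: gT])%g|)%N.
  by apply/card_gt0P; exists x; apply: class_refl.
by exists (Ordinal n_gt0); rewrite reps.1.
Qed.

Lemma coset_elts_unit i0 s :
  gamma i0 = 1%g :> gT -> {subset s <= 'C[x]%g} -> elts i0 s = s.
Proof.
move=> g0; elim: s => [//|h s IHs] sC /=.
have step0 : step i0 h = i0.
  by apply: (@coset_step_eq _ _ _ h); rewrite ?sC ?mem_head // g0 mul1g mulg1.
rewrite step0 IHs => [|u us]; last by apply: sC; rewrite inE us orbT.
by rewrite /coset_elt step0 g0 mul1g invg1 mulg1.
Qed.

(** * The prism homotopy *)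

Section Prism.
Variable k : fieldType.
Implicit Types f : seq gT -> k.
Local Notation tail := (@trivial_tail k gT).

Lemma trivial_tail_cons f h h' t :
  tail f h (h' :: t) = - f ((h * h')%g :: t) - tail (fun u => f (h :: u)) h' t.
Proof. by []. Qed.

(** A functor commutes with the faces of the nerve; here these are all faces but the one that drops
    h. *)
Lemma trivial_tail_coset_elts f i h t :
  tail (fun s => f (elts i s)) h t = tail f (elt i h) (elts (step i h) t).
Proof.
rewrite /trivial_tail; elim: t h i f => [//|h' t IHt] h i f /=.
rewrite coset_stepM coset_eltM; congr (_ - _).
exact: (IHt h' (step i h) (fun s => f (elt i h :: s))).
Qed.

(* The prism operator of the natural transformation with components gamma i   *)
(* between two functors from the action groupoid of the class of x to G: the  *)
(* one induced by coset_elts, and the projection (i, g) |-> g.                *)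
Fixpoint prism f i (s : seq gT) : k :=
  if s is h :: t then
    f (gamma i :: h :: t) - prism (fun u => f (elt i h :: u)) (step i h) t
  else f [:: gamma i].

Lemma eq_prism f f' i s :
  (forall u, size u = (size s).+1 -> f u = f' u) -> prism f i s = prism f' i s.
Proof.
elim: s i f f' => [|h t IHt] i f f' eq_f /=; first by rewrite eq_f.
by rewrite eq_f //; congr (_ - _); apply: IHt => u sz_u; rewrite eq_f //= sz_u.
Qed.

Lemma prism0 i s : prism (fun=> 0) i s = 0.
Proof. by elim: s i => //= h t IHt i; rewrite IHt subrr. Qed.

Lemma prismD f f' i s :
  prism (fun u => f u + f' u) i s = prism f i s + prism f' i s.
Proof.
elim: s i f f' => [//|h t IHt] i f f' /=.
by rewrite (IHt _ (fun u => f (_ :: u)) (fun u => f' (_ :: u))) opprD addrACA.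
Qed.

Lemma prismN f i s : prism (fun u => - f u) i s = - prism f i s.
Proof.
elim: s i f => [//|h t IHt] i f /=.
by rewrite (IHt _ (fun u => f (_ :: u))) opprB opprK addrC.
Qed.

Lemma prism_normalized f i s :
  (forall u, 1%g \in u -> f u = 0) -> 1%g \in s -> prism f i s = 0.
Proof.
elim: s i f => [//|h t IHt] i f nf; rewrite inE => /orP[/eqP<-|t1] /=.
  rewrite nf ?inE ?eqxx ?orbT // sub0r (@eq_prism _ (fun=> 0)) ?prism0 ?oppr0 //.
  by move=> u _; rewrite nf // coset_elt1 inE eqxx.
rewrite nf ?inE ?t1 ?orbT // IHt ?subrr // => u u1.
by rewrite nf // inE u1 orbT.
Qed.

Lemma trivial_tailB f f' h t :
  tail (fun u => f u - f' u) h t = tail f h t - tail f' h t.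
Proof.
rewrite /trivial_tail; elim: t h f f' => [|h' t IHt] h f f' /=.
  by rewrite opprB opprK addrC.
by rewrite (IHt _ (fun u => f (h :: u)) (fun u => f' (h :: u))); ring.
Qed.

Definition trivial_seq_diff f (s : seq gT) : k :=
  if s is h :: t then f t + tail f h t else 0.

(** The homotopy identity of a natural transformation. The bracketed term is the differential of
    [prism f] on the action groupoid, where dropping h moves the base index to [step i h]. Inner
    faces cancel by the naturality square [coset_eltE]. *)
Lemma prism_homotopy f i s :
  prism (trivial_seq_diff f) i s
    + (if s is h :: t then prism f (step i h) t + tail (prism f i) h t else 0)
  = f s - f (elts i s).
Proof.
elim: s i f => [|h t IHt] i f /=; first by rewrite /trivial_tail /= addr0 !subrr.
set h1 := elt i h; set s1 := step i h.
(* At a nonempty u, the differential of f at h1 :: u is f u - b u + c u minus the differential of fh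
   at u, and the induction hypothesis handles fh. *)
pose fh u := f (h1 :: u).
pose b u := if u is v :: w then f ((h1 * v)%g :: w) else 0.
pose c (u : seq gT) := if u is v :: w then fh w else 0.
have -> : prism (fun u => f u + tail f h1 u) s1 t
  = prism f s1 t - prism b s1 t + prism c s1 t - prism (trivial_seq_diff fh) s1 t.
  rewrite -!prismN -!prismD; apply: eq_prism => -[//|v w] _.
  by rewrite /trivial_tail /= -/(trivial_tail _ _ _); ring.
have /eqP := IHt s1 fh; rewrite eq_sym -subr_eq => /eqP <-.
case: t {IHt} => [|h2 t].
  by rewrite /trivial_tail /= /fh /b /c -coset_eltE -/h1 -/s1; ring.
rewrite !trivial_tail_cons.
have -> : tail (fun u => prism f i (h :: u)) h2 t
  = tail (fun u => f [:: gamma i, h & u]) h2 t - tail (prism fh s1) h2 t.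
  exact: trivial_tailB.
rewrite /= coset_stepM coset_eltM -coset_eltE -/h1 -/s1 /fh.
by ring.
Qed.

End Prism.
End Cosets.

(** * Restriction to a centralizer and extension from it *)

Section HatExt.
Variables (k : fieldType) (gT : finGroupType).
Local Notation hoch := (hoch_cochain k gT).
Local Notation d := (hoch_diff k gT).
Local Notation coch := (centralizer_cochain k).
Local Notation dC x := (@trivial_diff k gT 'C[x]%G).
Local Notation tail := (@trivial_tail k gT).

Lemma hatE x n (phi : hoch n) t : hat x phi t = adj phi x (unbar t).
Proof. by rewrite ffunE /= gcoefZ gcoef_geltl. Qed.

Lemma ceval_hat x n (phi : hoch n) s : size s = n -> {subset s <= 'C[x]%g} ->
  ceval (hat x phi) s = adj phi x s.
Proof.
move=> sz_s sC; rewrite -(@ceval_ffun _ _ 'C[x]%G k^o n (adj phi x) s) //.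
  by congr ceval; apply/ffunP => t; rewrite hatE ffunE.
by move=> t; apply: adj_normalized.
Qed.

Lemma hat_linear x n : linear (@hat k gT x n).
Proof.
move=> a phi psi; apply/ffunP => t.
by rewrite [RHS]ffunE [X in _ = X + _]ffunE !hatE adj_linear.
Qed.

HB.instance Definition _ x n :=
  GRing.isLinear.Build k (hoch n) (coch x n) *:%R (@hat k gT x n) (@hat_linear x n).

Lemma ceval_trivial_diff x n (psi : coch x n) h t :
    size t = n -> {subset h :: t <= 'C[x]%g} ->
  ceval (dC x n psi) (h :: t) = ceval psi t + tail (ceval psi) h t.
Proof.
move=> sz_t sC; rewrite (@ceval_bar_diff _ _ _ _ (fun=> idfun) (fun=> idfun)) //.
by rewrite /= sz_t.
Qed.

(** Elements of C_G(x) fix x under conjugation, so the action in [adj_diff] becomes trivial. *)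
Lemma hat_chain x n (phi : hoch n) : hat x (d n phi) = dC x n (hat x phi).
Proof.
apply: ceval_inj => -[//|h t] sz_s sC _; have [sz_t] := sz_s.
rewrite ceval_hat // adj_diff // ceval_trivial_diff //.
rewrite conjg_cent ?sC ?mem_head // ceval_hat //; last first.
  by move=> u tu; apply: sC; rewrite inE tu orbT.
congr (_ + _); apply: (@eq_in_bar_tail _ 'C[x]%G) => // s sz_st sC'.
by rewrite ceval_hat // sz_st.
Qed.

Section Ext.
Variables (gamma : coset_family gT).

(** The inverse of Shapiro's map: under [adj], the coefficient at x_i is psi pulled back along
    [coset_elts] from i, and the coefficients off the class of x are 0. *)
Definition ext x n (psi : coch x n) : hoch n :=
  unadj n (fun u s =>
    \sum_i (@class_elt gT gamma x i == u)%:R * ceval psi (coset_elts gamma i s)).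

Lemma ext_linear x n : linear (@ext x n).
Proof.
move=> a phi psi; apply/ffunP => t; apply: gcoefP => v.
rewrite ffunE [RHS]/gcoef !ffunE /gcoef !ffunE.
rewrite scalerAr -mulrDr scaler_sumr -big_split; congr (_ * _).
by apply: eq_bigr => i _; rewrite cevalP mulrDr scalerAr.
Qed.

HB.instance Definition _ x n :=
  GRing.isLinear.Build k (coch x n) (hoch n) *:%R (@ext x n) (@ext_linear x n).

Variable x : gT.
Hypothesis reps : right_coset_reps (@gamma x).
Local Notation step := (@coset_step gT gamma x).
Local Notation elts := (@coset_elts gT gamma x).
Local Notation conj := (@class_elt gT gamma x).

Lemma adj_ext n (psi : coch x n) u s : size s = n ->
  adj (ext psi) u s = \sum_i (conj i == u)%:R * ceval psi (elts i s).
Proof.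
move=> sz_s; rewrite adj_unadj // => v t t1; rewrite big1 // => i _.
by rewrite ceval1 ?mulr0 // mem1_coset_elts.
Qed.

Lemma sum_class_elt (F : 'I_#|(x ^: [set: gT])%g| -> k) i0 u :
  conj i0 = u -> \sum_i (conj i == u)%:R * F i = F i0.
Proof.
move=> <-; rewrite (bigD1 i0) //= eqxx mul1r big1 ?addr0 // => i i_neq.
by rewrite (inj_eq (class_elt_inj reps)) (negPf i_neq) mul0r.
Qed.

Lemma trivial_tail_sum (I : finType) (c : I -> k) (f : I -> seq gT -> k) h t :
  tail (fun s => \sum_i c i * f i s) h t = \sum_i c i * tail (f i) h t.
Proof.
rewrite /trivial_tail; elim: t h f => [|h' t IHt] h f /=.
  by rewrite -sumrN; apply: eq_bigr => i _; rewrite mulrN.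
rewrite (IHt h' (fun i u => f i (h :: u))) -sumrN -sumrB.
by apply: eq_bigr => i _; rewrite mulrBr mulrN.
Qed.

Lemma ext_chain n (psi : coch x n) : ext (dC x n psi) = d n (ext psi).
Proof.
apply: adj_inj => u [//|h t] sz_s; have [sz_t] := sz_s.
rewrite adj_diff // !adj_ext //.
rewrite /trivial_tail (@eq_bar_tail _ _ _ _
  (fun s => \sum_i (conj i == u)%:R * ceval psi (elts i s))); last first.
  by move=> s sz_st; rewrite adj_ext // sz_st.
rewrite -/(tail _ _ _) trivial_tail_sum.
(* Conjugation by h permutes the class, which matches the terms at u ^ h with those at u. *)
rewrite [X in _ = X + _](reindex_inj (@coset_step_inj _ _ _ reps h)) /= -big_split /=.
apply: eq_bigr => i _; rewrite class_elt_step //.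
have -> : (conj i ^ h == u ^ h)%g = (conj i == u) by exact: (inj_eq (conjg_inj h)).
rewrite -mulrDr trivial_tail_coset_elts // ceval_trivial_diff ?size_coset_elts //.
exact: (@coset_elts_cent _ _ _ reps i (h :: t)).
Qed.

Lemma hat_ext n (psi : coch x n) : hat x (ext psi) = psi.
Proof.
have [i0 g0] := coset_unit_index reps.
apply: ceval_inj => s sz_s sC _; rewrite ceval_hat // adj_ext //.
have x0 : conj i0 = x by rewrite class_eltE g0 conjg1.
by rewrite (sum_class_elt _ x0) coset_elts_unit.
Qed.

Lemma hat_ext_neq z n (psi : coch x n) :
  z \notin (x ^: [set: gT])%g -> hat z (ext psi) = 0.
Proof.
move=> zx; apply: ceval_inj => s sz_s sC _; rewrite ceval_hat // adj_ext // ceval0.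
rewrite big1 // => i _; case: eqP => [def_z|]; last by rewrite mul0r.
by case/imsetP: zx; exists (gamma i); rewrite ?inE // -def_z class_eltE.
Qed.

End Ext.

Lemma cup_componentE (gamma : coset_family gT) x y z n m
    (phi : coch x n) (psi : coch y m) :
    right_coset_reps (@gamma x) -> right_coset_reps (@gamma y) ->
  cup_component gamma z phi psi = hat z (hoch_cup (ext gamma phi) (ext gamma psi)).
Proof.
move=> repsx repsy; apply/ffunP => t; rewrite hatE ffunE; set s := unbar t => /=.
have sz_s : size s = (n + m)%N by rewrite size_map size_tuple.
rewrite adj_cup //; set g := (\prod_(h <- take m s) h)%g; congr (_ * _).
pose A := fun i => ceval phi (@coset_elts gT gamma x i (drop m s)).
pose B := fun j => ceval psi (@coset_elts gT gamma y j (take m s)).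
have eq_conj (a b : gT) : (b == g * a^-1 * g^-1 * z)%g = (g * a * g^-1 * b == z)%g.
  rewrite -[RHS](inj_eq (mulgI (g * a^-1 * g^-1)%g)).
  by rewrite !mulgA mulgKV mulgKV mulgV mul1g.
transitivity (\sum_i \sum_j
    (@class_elt gT gamma y j
      == g * (@class_elt gT gamma x i)^-1 * g^-1 * z)%g%:R * (A i * B j)).
  rewrite pair_big /= big_mkcond /=; apply: eq_bigr => -[i j] _ /=.
  rewrite eq_conj.
  by case: eqP => _; rewrite ?mul1r ?mul0r.
have sz_d : size (drop m s) = n by rewrite size_drop sz_s addnK.
have sz_t : size (take m s) = m by rewrite size_takel // sz_s leq_addl.
under [RHS]eq_bigr do rewrite !adj_ext // mulr_suml.
rewrite [RHS]exchange_big; apply: eq_bigr => i _ /=.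
(* For fixed i the sum over u has its only nonzero term at u = x_i. *)
rewrite [RHS](bigD1 (class_elt gamma i)) //= [X in _ = _ + X]big1 => [|u ui]; last first.
  by rewrite eq_sym (negPf ui) !mul0r.
rewrite eqxx mul1r addr0 mulr_sumr; apply: eq_bigr => j _.
by rewrite mulrCA.
Qed.

(** * Homotopy between the identity and extension after restriction *)

Section Transversal.
Variables (gamma : coset_family gT) (X : {set gT}).
Hypothesis X_repr : is_transversal X (classes [set: gT]) [set: gT].
Hypothesis reps : forall x, x \in X -> right_coset_reps (@gamma x).

Lemma transversal_class_eq x y : x \in X -> y \in X ->
  y \in (x ^: [set: gT])%g -> x = y.
Proof.
move=> xX yX yx; case/and3P: X_repr => _ _ /forallP/(_ (x ^: [set: gT])%g).
rewrite mem_classes ?inE //= => /cards1P[z /setP Xz].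
have := Xz x; have := Xz y; rewrite !inE xX yX yx class_refl /=.
by move=> /esym/eqP-> /esym/eqP->.
Qed.

Lemma transversal_class_elt u :
  exists2 x, x \in X & exists i, @class_elt gT gamma x i = u.
Proof.
case/and3P: X_repr => _ _ /forallP/(_ (u ^: [set: gT])%g).
rewrite mem_classes ?inE //= => /cards1P[x /setP/(_ x)].
rewrite !inE eqxx class_sym => /andP[xX /imsetP[g _ ->]]; exists x => //.
exact: class_elt_onto (reps xX) g.
Qed.

(** The elements x_i, for x in X and all i, list G without repetition, so coefficients may be
    prescribed at each pair (x, i). *)
Lemma sum_transversal (F : forall x, 'I_#|(x ^: [set: gT])%g| -> k) x i :
    x \in X ->
  \sum_(y in X) \sum_j (class_elt gamma j == @class_elt gT gamma x i)%:R * F y j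
  = F x i.
Proof.
move=> xX; rewrite (bigD1 x) //= (sum_class_elt (reps xX) _ erefl) big1 ?addr0 //.
move=> y /andP[yX yx]; rewrite big1 // => j _.
case: eqP => [eq_ij|]; last by rewrite mul0r.
case/eqP: yx; apply/esym/transversal_class_eq => //; rewrite class_sym.
have <- : (y ^ (gamma j * (gamma i)^-1) = x)%g.
  by rewrite conjgM -class_eltE eq_ij class_eltE conjgK.
exact: memJ_class (in_setT _).
Qed.

Lemma adj_sum n (I : Type) (r : seq I) (P : pred I) (F : I -> hoch n) u s :
  adj (\sum_(i <- r | P i) F i) u s = \sum_(i <- r | P i) adj (F i) u s.
Proof.
apply: (big_morph (fun phi : hoch n => adj phi u s)) => [phi psi|].
  by have := adj_linear u s 1 phi psi; rewrite !scale1r.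
by rewrite /adj ceval0 /gcoef ffunE mulr0.
Qed.

(** For a cocycle, the trivial differential of [adj phi x] measures the change from x to x ^ h. It
    vanishes when the first argument centralizes x, so of the prism only the term starting with
    [gamma i] remains. *)
Lemma prism_cocycle x n (phi : hoch n) i s :
    x \in X -> phi \in cocycles d n -> size s = n ->
  prism gamma (trivial_seq_diff (adj phi x)) i s
  = adj phi x s - adj phi (@class_elt gT gamma x i) s.
Proof.
move=> xX; rewrite mem_cocycles => /eqP dphi sz_s.
have dE h t : size t = n ->
    trivial_seq_diff (adj phi x) (h :: t) = adj phi x t - adj phi (x ^ h) t.
  move=> sz_t; have := adj_diff phi x h sz_t.
  rewrite dphi /adj ceval0 /gcoef ffunE mulr0 -/(gcoef _ _) => /esym/eqP.
  by rewrite addrC addr_eq0 /= => /eqP->.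
case: s sz_s => [|h t] sz_s /=.
  by rewrite -/(trivial_seq_diff (adj phi x) [:: gamma i]) dE // class_eltE.
rewrite -/(trivial_seq_diff (adj phi x) [:: gamma i, h & t]) dE // -class_eltE.
rewrite (@eq_prism _ _ _ _ _ (fun=> 0)) ?prism0 ?subr0 // => u sz_u.
rewrite -/(trivial_seq_diff (adj phi x) (_ :: u)) dE ?sz_u //.
by rewrite (conjg_cent (coset_elt_cent (reps xX) i h)) subrr.
Qed.

(** At x_i, [prism_cocycle] cancels adj phi x s in the prism identity and leaves adj phi x_i s - adj
    phi x (elts i s), the coefficient of the left side, as a differential. *)
Lemma ext_hat_homotopic n (phi : hoch n) : phi \in cocycles d n ->
  phi - \sum_(x in X) ext gamma (hat x phi) \in coboundaries d n.
Proof.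
move=> Zphi.
(* The prism reads one more argument than it is given, so the degree of the primitive is one less
   than n; m stays free until the case split on n. *)
pose chi m : hoch m := unadj m (fun u s => \sum_(x in X)
  \sum_i (@class_elt gT gamma x i == u)%:R * prism gamma (adj phi x) i s).
have adj_chi m x i s : x \in X -> size s = m ->
    adj (chi m) (@class_elt gT gamma x i) s = prism gamma (adj phi x) i s.
  move=> xX sz_s; rewrite adj_unadj // ?sum_transversal // => v t t1.
  rewrite big1 // => y yX; rewrite big1 // => j _.
  by rewrite (prism_normalized (reps yX)) ?mulr0 // => w; apply: adj_normalized.
have adj_res x i s : x \in X -> size s = n ->
    adj (phi - \sum_(x in X) ext gamma (hat x phi)) (@class_elt gT gamma x i) s
    = if s is h :: t
      then prism gamma (adj phi x) (coset_step gamma i h) t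
           + trivial_tail (prism gamma (adj phi x) i) h t
      else 0.
  move=> xX sz_s; have := prism_homotopy (reps xX) (adj phi x) i s.
  rewrite prism_cocycle // => /(canRL (addKr _)) ->.
  rewrite -scaleN1r addrC adj_linear scaleN1r adj_sum addrC.
  under eq_bigr => y yX do rewrite (adj_ext (reps yX)) //.
  rewrite sum_transversal // ceval_hat ?size_coset_elts //; last first.
    exact: coset_elts_cent (reps xX) i s.
  by ring.
case: n phi Zphi chi adj_chi adj_res => [|n] phi Zphi chi adj_chi adj_res.
  (* In degree 0 there are no coboundaries, and the difference itself is 0. *)
  rewrite memv0; apply/eqP/adj_inj => u s sz_s.
  have [x xX [i <-]] := transversal_class_elt u; rewrite adj_res //.
  by case: s sz_s => // _; rewrite /adj ceval0 /gcoef ffunE mulr0.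
apply/mem_coboundariesS; exists (chi n); apply: adj_inj => u [//|h t] sz_s.
have [sz_t] := sz_s; have [x xX [i <-]] := transversal_class_elt u.
rewrite adj_res // adj_diff // -class_elt_step ?adj_chi //; last exact: reps.
congr (_ + _); apply: eq_bar_tail => s sz_st.
by rewrite adj_chi // sz_st.
Qed.

End Transversal.

End HatExt.

(** * Transport of a graded algebra structure along linear bijections *)

Lemma raddf_sum_of_linear (k : fieldType) (U V : lmodType k) (f : U -> V) :
    linear f ->
  forall (I : Type) (r : seq I) (F : I -> U),
  f (\sum_(i <- r) F i) = \sum_(i <- r) f (F i).
Proof.
move=> f_lin I r F; apply: (big_morph f) => [u v|].
  by have := f_lin 1 u v; rewrite !scale1r.
by have := f_lin (-1) 0 0; rewrite scaler0 addr0 scaleN1r addNr.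
Qed.

Section Transport.
Variables (k : fieldType) (A B : nat -> lmodType k).
Variable mulA : forall n m, A n -> A m -> A (n + m)%N.
Variable mulB : forall n m, B n -> B m -> B (n + m)%N.
Variables (oneA : A 0%N) (oneB : B 0%N).
Variables (f : forall n, A n -> B n) (g : forall n, B n -> A n).
Hypothesis algA : graded_algebra mulA oneA.
Hypothesis f_lin : forall n, linear (@f n).
Hypotheses (fK : forall n, cancel (@f n) (@g n)) (gK : forall n, cancel (@g n) (@f n)).
Hypothesis mulBE : forall n m (a : B n) (b : B m), mulB a b = f (mulA (g a) (g b)).
Hypothesis oneBE : oneB = f oneA.

Lemma transport_graded_algebra : graded_algebra mulB oneB.
Proof.
have g_lin n : linear (@g n).
  by move=> c a b; apply: (can_inj (@fK n)); rewrite f_lin !gK.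
have f_cast m n (e : m = n) (a : A m) : f (deg_cast e a) = deg_cast e (f a).
  by case: n / e.
case: algA => mul_l mul_r mul_assoc mul_1l mul_1r.
split=> [n m b c a a'|n m a c b b'|n m p a b c|n a|n a].
- by rewrite !mulBE g_lin mul_l f_lin.
- by rewrite !mulBE g_lin mul_r f_lin.
- by rewrite !mulBE !fK -f_cast mul_assoc.
- by rewrite mulBE oneBE fK -f_cast mul_1l gK.
- by rewrite mulBE oneBE fK -f_cast mul_1r gK.
Qed.

Lemma transport_graded_algebra_iso : graded_algebra_iso mulA oneA mulB oneB f.
Proof.
split=> // [n|n m a b]; first by exists (@g n).
by rewrite mulBE !fK.
Qed.

End Transport.

Lemma dproj_linear (k : fieldType) (I : finType) (V : I -> lmodType k) i :
  linear (fun a : dsum V => dproj a i).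
Proof. by move=> c a b; rewrite [LHS]dtupleE; congr (_ + _); apply: dtupleE. Qed.

(** * The isomorphism and the transported product *)

Section Iso.
Variables (k : fieldType) (gT : finGroupType).
Local Notation hoch := (hoch_cochain k gT).
Local Notation d := (hoch_diff k gT).
Local Notation coch := (centralizer_cochain k).
Variables (gamma : coset_family gT) (X : {set gT}).
Hypothesis X_repr : is_transversal X (classes [set: gT]) [set: gT].
Hypothesis reps : forall x, x \in X -> right_coset_reps (@gamma x).
Local Notation Xt := {x : gT | x \in X}.

Lemma hat_cocycle x n (phi : hoch n) :
  phi \in cocycles d n -> hat x phi \in centralizer_cocycles k x n.
Proof. exact: (chain_map_cocycle (F := fun n => @hat k gT x n) (@hat_chain k gT x)). Qed.

Lemma hat_isoE n (phi : hoch n) : phi \in cocycles d n ->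
  hat_iso X (cohom_class d phi)
  = dtuple (fun x : Xt => centralizer_class (hat (val x) phi)).
Proof.
move=> Zphi; apply: dprojP => x; rewrite !dtupleE.
exact: (chain_map_class (F := fun n => @hat k gT (val x) n) (@hat_chain k gT _)).
Qed.

Lemma hat_iso_linear n : linear (@hat_iso k gT X n).
Proof.
move=> a u v; apply: dprojP => x.
rewrite dproj_linear !dtupleE.
exact: (chain_map_class_linear (F := fun n => @hat k gT (val x) n) (@hat_chain k gT _)).
Qed.

Definition ext_class x n (c : group_cohom k 'C[x]%G n) : HH k gT n :=
  cohom_class d (ext gamma (cohom_repr c)).

Lemma ext_classE x n (psi : coch x n) :
    x \in X -> psi \in centralizer_cocycles k x n ->
  ext_class (centralizer_class psi) = cohom_class d (ext gamma psi).
Proof.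
move=> xX; apply: (chain_map_class (F := fun n => @ext k gT gamma x n)).
exact: ext_chain (reps xX).
Qed.

Lemma ext_cocycle x n (psi : coch x n) : x \in X ->
  psi \in centralizer_cocycles k x n -> ext gamma psi \in cocycles d n.
Proof.
move=> xX; apply: (chain_map_cocycle (F := fun n => @ext k gT gamma x n)).
exact: ext_chain (reps xX).
Qed.

Definition ext_iso n (c : centralizer_sum k X n) : HH k gT n :=
  \sum_x ext_class (dproj c x).

Lemma hat_isoK n : cancel (@hat_iso k gT X n) (@ext_iso n).
Proof.
move=> c; have [phi Zphi ->] := HH_ex c; rewrite /ext_iso.
under eq_bigr => x _ do rewrite hat_isoE // dtupleE ext_classE ?(valP x) ?hat_cocycle //.
rewrite -linear_sum -(big_sub X (fun x => ext gamma (hat x phi))).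
apply/esym/cohom_classP => //; last exact: ext_hat_homotopic.
by apply: rpred_sum => x xX; rewrite ext_cocycle ?hat_cocycle.
Qed.

Lemma ext_isoK n : cancel (@ext_iso n) (@hat_iso k gT X n).
Proof.
move=> c; rewrite /ext_iso /ext_class -linear_sum hat_isoE; last first.
  by apply: rpred_sum => x _; rewrite ext_cocycle ?(valP x) ?cohom_repr_cocycle.
apply: dprojP => z; rewrite dtupleE linear_sum /= (bigD1 z) //=.
rewrite (hat_ext (reps (valP z))) big1 ?addr0 => [|x xz].
  exact: cohom_reprK.
rewrite (hat_ext_neq (reps (valP x))) //; apply/negP => zx; case/eqP: xz; apply/val_inj.
exact: (transversal_class_eq X_repr (valP x) (valP z)).
Qed.

Lemma cup_class_ext x y n m (a : group_cohom k 'C[x]%G n) (b : group_cohom k 'C[y]%G m) :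
    x \in X -> y \in X ->
  cup_class gamma X a b = hat_iso X (HH_mul (ext_class a) (ext_class b)).
Proof.
move=> xX yX; have Za := ext_cocycle xX (cohom_repr_cocycle a).
have Zb := ext_cocycle yX (cohom_repr_cocycle b).
rewrite HH_mulE // hat_isoE ?hoch_cup_cocycle //; apply: dprojP => z.
by rewrite !dtupleE cup_componentE //; apply: reps.
Qed.

(** Bilinearity reduces the claim to one pair of components, where [cup_class_ext] applies. *)
Lemma centralizer_mulE n m (a : centralizer_sum k X n) (b : centralizer_sum k X m) :
  centralizer_mul gamma a b = hat_iso X (HH_mul (ext_iso a) (ext_iso b)).
Proof.
have [mul_l mul_r _ _ _] := HH_graded_algebra k gT.
rewrite /centralizer_mul /ext_iso (raddf_sum_of_linear (mul_l n m _)).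
rewrite (raddf_sum_of_linear (@hat_iso_linear _)); apply: eq_bigr => x _.
rewrite (raddf_sum_of_linear (mul_r n m _)).
rewrite (raddf_sum_of_linear (@hat_iso_linear _)); apply: eq_bigr => y _.
by rewrite cup_class_ext ?(valP x) ?(valP y).
Qed.

(** The unit of kG has coefficient 1 at the identity of G and 0 elsewhere. *)
Lemma centralizer_oneE : centralizer_one k X = hat_iso X (HH_one k gT).
Proof.
rewrite hat_isoE ?hoch_one_cocycle //; apply: dprojP => x; rewrite !dtupleE.
congr centralizer_class; apply/ffunP => t; rewrite hatE ffunE (tuple0 t) /=.
rewrite /adj /adj_sign mul0n expr0 mul1r big_nil invg1 mul1g.
by rewrite (ceval_hoch_one k gT) geltE.
Qed.

End Iso.

Theorem theorem7p2 (k : fieldType) (gT : finGroupType) (X : {set gT})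
    (X_repr : is_transversal X (classes [set: gT]) [set: gT])
    (gamma : coset_family gT)
    (gamma_reps : forall x, x \in X -> right_coset_reps (gamma x)) :
  (* the cup product is well defined on HH^*(kG), a graded algebra *)
  ((forall n m (phi : hoch_cochain k gT n) (psi : hoch_cochain k gT m),
      phi \in cocycles (hoch_diff k gT) n ->
      psi \in cocycles (hoch_diff k gT) m ->
      hoch_cup phi psi \in cocycles (hoch_diff k gT) (n + m)
      /\ HH_mul (cohom_class (hoch_diff k gT) phi)
                (cohom_class (hoch_diff k gT) psi)
         = cohom_class (hoch_diff k gT) (hoch_cup phi psi))
   /\ graded_algebra (@HH_mul k gT) (HH_one k gT))
  (* the product on the direct sum is well defined and gives a graded algebra *)
  /\ ((forall x y, x \in X -> y \in X ->
       forall n m (phi : centralizer_cochain k x n)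
                  (psi : centralizer_cochain k y m),
       phi \in centralizer_cocycles k x n ->
       psi \in centralizer_cocycles k y m ->
       (forall z, z \in X ->
          cup_component gamma z phi psi \in centralizer_cocycles k z (n + m))
       /\ cup_class gamma X (centralizer_class phi) (centralizer_class psi)
          = dtuple (fun z : {x : gT | x \in X} =>
              centralizer_class (cup_component gamma (val z) phi psi)))
     /\ graded_algebra (@centralizer_mul k gT gamma X) (centralizer_one k X))
  (* the isomorphism is well defined and is one of graded algebras *)
  /\ ((forall n (phi : hoch_cochain k gT n),
        phi \in cocycles (hoch_diff k gT) n ->
        (forall x, x \in X -> hat x phi \in centralizer_cocycles k x n)
        /\ hat_iso X (cohom_class (hoch_diff k gT) phi)
           = dtuple (fun x : {x : gT | x \in X} =>
               centralizer_class (hat (val x) phi)))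
     /\ graded_algebra_iso (@HH_mul k gT) (HH_one k gT)
          (@centralizer_mul k gT gamma X) (centralizer_one k X)
          (@hat_iso k gT X)).
Proof.
have HH_alg := HH_graded_algebra k gT.
have f_lin := @hat_iso_linear k gT X.
have fK := hat_isoK X_repr gamma_reps (k := k).
have gK := ext_isoK X_repr gamma_reps (k := k).
have mulE := centralizer_mulE gamma_reps (k := k).
have oneE := @centralizer_oneE k gT X.
split; [split=> [n m phi psi Zphi Zpsi|//] | split; split].
- by rewrite HH_mulE ?hoch_cup_cocycle.
- move=> x y xX yX n m phi psi Zphi Zpsi.
  have Zx := ext_cocycle gamma_reps xX Zphi.
  have Zy := ext_cocycle gamma_reps yX Zpsi.
  split=> [z zX|].
    rewrite cup_componentE; [|exact: gamma_reps..].
    by rewrite hat_cocycle ?hoch_cup_cocycle.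
  rewrite (cup_class_ext gamma_reps) // !(ext_classE gamma_reps) // HH_mulE //.
  rewrite hat_isoE ?hoch_cup_cocycle //; apply: dprojP => z.
  by rewrite !dtupleE cup_componentE //; apply: gamma_reps.
- exact: (transport_graded_algebra HH_alg f_lin fK gK mulE oneE).
- move=> n phi Zphi; split=> [x _|]; first exact: hat_cocycle.
  exact: hat_isoE.
- exact: (transport_graded_algebra_iso f_lin fK gK mulE oneE).
Qed.
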